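(* There exists an algorithm that, given a sock ordering of length $N$, determines whether it is foot-sortable or not, and runs in $O(N\log N)$ time.
   Context: A sock ordering of length $N$ is a finite string $s_0s_1\cdots s_{N-1}$ of letters; each entry is a sock and its letter is its color. The input is given as a sequence of integers $s[0],\ldots,s[N-1]$ in $[0,N)$, where $s[i]$ represents the color of the $i$-th sock. Running time is measured in the standard random-access model in which elementary operations (comparisons, arithmetic, memory and pointer access) on integers of size $O(N)$ take constant time. Sorting with a stack (one foot): the socks are read from left to right and each is pushed onto the top of a stack; at any time the top sock of the stack may be popped and appended to the output; at the end all socks have been output. A sock ordering is foot-sortable if the stack operations can be chosen so that in the output the socks of each color form a contiguous block. *)

(* Defs.v *)
From mathcomp Require Import all_boot.

Set Implicit Arguments.
Unset Strict Implicit.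
Unset Printing Implicit Defensive.

(* [foot_run s st o]: with remaining input [s] and stack [st] (head = top),
   some sequence of operations exhausts input and stack and appends exactly [o]
   to the output. *)
Inductive foot_run (T : Type) : seq T -> seq T -> seq T -> Prop :=
| FootDone : foot_run [::] [::] [::]
| FootPush x s st o : foot_run s (x :: st) o -> foot_run (x :: s) st o
| FootPop x s st o : foot_run s st o -> foot_run s (x :: st) (x :: o).

Definition contiguous_colors (T : Type) (o : seq T) : Prop :=
  forall (x0 : T) (i j k : nat), i <= j -> j <= k -> k < size o ->
    nth x0 o i = nth x0 o k -> nth x0 o j = nth x0 o i.

Definition foot_sortable (T : Type) (s : seq T) : Prop :=
  exists2 o : seq T, foot_run s [::] o & contiguous_colors o.

Inductive operand := Cst of nat | Reg of nat.

(* [Sub] is truncated; [Div] and [Mod] are the total operations of ssrnat/div. *)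
Inductive arith := Add | Sub | Mul | Div | Mod.

Inductive instr :=
| Op of arith & nat & operand & operand  (* r_d := a op b *)
| Read of nat & operand                  (* r_d := mem[a] *)
| Write of operand & operand             (* mem[a] := b *)
| JmpEq of operand & operand & nat       (* if a = b goto l *)
| JmpLt of operand & operand & nat       (* if a < b goto l *)
| Halt of bool.                          (* stop with this answer *)

Definition program := seq instr.

(* Only the finitely many registers named by the (fixed) program are ever used;
   the memory is the random-access store. *)
Record state := State { pc : nat; reg : nat -> nat; mem : nat -> nat }.

Definition upd (f : nat -> nat) (a v : nat) : nat -> nat :=
  fun b => if b == a then v else f b.

Definition operand_val (st : state) (a : operand) : nat :=
  match a with Cst n => n | Reg r => reg st r end.

Definition arith_val (op : arith) (m n : nat) : nat :=
  match op with
  | Add => m + n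
  | Sub => m - n
  | Mul => m * n
  | Div => m %/ n
  | Mod => m %% n
  end.

(* [W] is the word bound: an instruction that would write a number, or use an
   address, that is not smaller than [W] has no successor state, so such a run
   never produces an answer. *)
Definition exec (W : nat) (i : instr) (st : state) : option state :=
  let val := operand_val st in
  match i with
  | Op op d a b =>
      let v := arith_val op (val a) (val b) in
      if v < W then Some (State (pc st).+1 (upd (reg st) d v) (mem st)) else None
  | Read d a =>
      let v := mem st (val a) in
      if (val a < W) && (v < W)
      then Some (State (pc st).+1 (upd (reg st) d v) (mem st)) else None
  | Write a b =>
      if (val a < W) && (val b < W)
      then Some (State (pc st).+1 (reg st) (upd (mem st) (val a) (val b)))
      else None
  | JmpEq a b l =>
      Some (State (if val a == val b then l else (pc st).+1) (reg st) (mem st))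
  | JmpLt a b l =>
      Some (State (if val a < val b then l else (pc st).+1) (reg st) (mem st))
  | Halt _ => None
  end.

(* [halts_in W P st t b]: started in [st], [P] executes exactly [t] instructions,
   the last one being [Halt b]. *)
Inductive halts_in (W : nat) (P : program) : state -> nat -> bool -> Prop :=
| HaltsNow st b :
    onth P (pc st) = Some (Halt b) -> halts_in W P st 1 b
| HaltsStep st st' i t b :
    onth P (pc st) = Some i -> exec W i st = Some st' ->
    halts_in W P st' t b -> halts_in W P st t.+1 b.

(* Register 0 holds the length of the input, memory cell [i] holds its [i]-th
   entry, and everything else is 0. *)
Definition init_state (s : seq nat) : state :=
  State 0 (upd (fun=> 0) 0 (size s)) (fun i => nth 0 s i).

Definition bigO (f g : nat -> nat) : Prop :=
  exists C n0 : nat, forall n : nat, n0 <= n -> f n <= C * g n.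

(* Main.v *)
Require Import Defs.
From mathcomp Require Import all_boot zify.

(* A sock ordering is foot-sortable iff its colours can be ranked so that no
   subsequence a b c of distinct colours has c < a < b: the rank of a colour is the
   place of its block in the output. The algorithm builds such a ranking greedily.
   The stack splits into a committed part u, whose colours must leave from the top,
   and a part t above it whose colours, distinct and each pushed as one block, are
   still unordered. Nothing is decided until an input sock z is buried in the stack
   under other colours g. If x is the colour of least rank among those still to come,
   then x = z, or every colour of g is finished except possibly x itself. Hence: if g
   contains only finished colours, pop them; if it contains at least two unfinished
   ones, z leaves next; if it contains a single one e, then of z and e the one whose
   last sock comes first leaves next, except that e leaves when finished colours
   above e would get in the way of z. If z is buried in u, only the top of u can
   leave. While the chosen colour leaves, the other colours met on the way must again
   form blocks, and the whole stack becomes committed. Each of these steps handles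
   only the uncommitted part and the socks that it reads, so the total running time
   is linear. *)

Set Implicit Arguments.
Unset Strict Implicit.
Unset Printing Implicit Defensive.

(** * Orders of the colours *)

(** No decision is ever revised, because each is proved as an equivalence between sortability before
    and after it. Forwards, take any ranking and its colour [x] of least rank among the remaining
    socks: either [x] is the chosen colour, or the remaining input is so constrained that the same
    ranking also fits the new, more committed stack. Backwards, the chosen colour is moved to the
    front of a ranking of the new configuration.

    One invariant carries the argument: the top of the committed part is unfinished. Its rank is
    then at least that of [x], so [x] bounds the ranks of all committed colours from below. This is
    why finished colours are removed from the top after each commitment.

    A finished colour [f] above an unfinished [e] above [z] cannot leave before [z] if [z] leaves
    before [e], since [z e f] would be forbidden. Hence, when [z] is chosen, finished colours are
    removed only below [e]. *)

Section SubseqFacts.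
Variable T : eqType.
Implicit Types (a b c : T) (s t : seq T).

Lemma subseq2_cat a b s t :
  subseq [:: a; b] (s ++ t) =
  [|| subseq [:: a; b] s, (a \in s) && (b \in t) | subseq [:: a; b] t].
Proof.
elim: s => [|x s IH]; first by [].
rewrite cat_cons /= in_cons; have [->|nax] /= := eqVneq a x; last exact: IH.
rewrite !sub1seq mem_cat; case: (b \in s) => //=; case: (boolP (b \in t)) => //= nb.
by apply/esym/negbTE; apply: contra nb => /mem_subseq; apply; rewrite !inE eqxx orbT.
Qed.

Lemma subseq3_cat a b c s t :
  subseq [:: a; b; c] (s ++ t) =
  [|| subseq [:: a; b; c] s, subseq [:: a; b] s && (c \in t),
      (a \in s) && subseq [:: b; c] t | subseq [:: a; b; c] t].
Proof.
elim: s => [|x s IH]; first by [].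
rewrite cat_cons /= in_cons; have [->|nax] /= := eqVneq a x; last exact: IH.
rewrite subseq2_cat sub1seq; case: (subseq [:: b; c] s) => //=.
case: ((b \in s) && _) => //=; case: (boolP (subseq [:: b; c] t)) => //= nb.
apply/esym/negbTE; apply: contra nb; apply: subseq_trans.
exact: subseq_cons.
Qed.

Lemma subseq2_mem a b s : subseq [:: a; b] s -> (a \in s) /\ (b \in s).
Proof. by move=> /mem_subseq h; split; apply: h; rewrite !inE eqxx ?orbT. Qed.

Lemma subseq_rcons_last s r c t : subseq (rcons r c) (s ++ t) -> c \notin t ->
  subseq (rcons r c) s.
Proof.
elim/last_ind: t => [|t y IH]; first by rewrite cats0.
rewrite -rcons_cat mem_rcons inE negb_or => h /andP[ncy nct].
apply: IH => //; move: h; rewrite -[subseq (rcons r c) _]subseq_rev.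
by rewrite !rev_rcons /= (negbTE ncy) -rev_rcons subseq_rev.
Qed.

(** A pattern without equal neighbours uses at most one of two adjacent equal socks, so merging
    these loses no pattern. *)
Lemma subseq_stutter r s y t : sorted (fun a b => a != b) r ->
  subseq r (s ++ [:: y, y & t]) -> subseq r (s ++ y :: t).
Proof.
elim: s r => [|x s IH] [|a r] hr; rewrite ?sub0seq // ?cat_cons /=.
  case: eqP => [ay|/eqP/negbTE nay]; last by rewrite nay.
  case: r hr => [|b r /= /andP[ab _]]; first by rewrite sub0seq.
  by rewrite -ay eq_sym (negbTE ab).
case: eqP => _; last exact: IH.
by apply: IH; apply: path_sorted hr.
Qed.

End SubseqFacts.

(** Ranks do not increase from the bottom to the top, so popping outputs them in order. The
    inequality is weak because a colour may be stacked several times. *)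
Definition dec (rho : nat -> nat) (u : seq nat) :=
  forall a b, subseq [:: a; b] u -> rho b <= rho a.

(** This is Knuth's pattern 231 for stack sorting, read through the ranking. *)
Definition avoids (rho : nat -> nat) (s : seq nat) :=
  forall a b c, subseq [:: a; b; c] s -> ~~ (rho c < rho a < rho b).

(* The stack [u] (bottom first) is frozen: its colours must leave from the top. *)
Definition sortable_from (u v : seq nat) :=
  exists2 rho : nat -> nat, injective rho & dec rho u /\ avoids rho (u ++ v).

Lemma dec_subseq rho u v : subseq u v -> dec rho v -> dec rho u.
Proof. by move=> uv dv a b /subseq_trans/(_ uv); apply: dv. Qed.

Lemma avoids_subseq rho u v : subseq u v -> avoids rho v -> avoids rho u.
Proof. by move=> uv dv a b c /subseq_trans/(_ uv); apply: dv. Qed.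

(** * Sortability as the existence of a ranking *)

Lemma foot_run_mem (T : eqType) (s st o : seq T) :
  foot_run s st o -> o =i st ++ s.
Proof.
elim=> //= [x s' st' o' _ IH|x s' st' o' _ IH] y.
  by rewrite IH !mem_cat !inE mem_cat; do !case: (_ \in _); rewrite ?orbT.
by rewrite !inE IH.
Qed.

(** A push leaves [rev st ++ s] unchanged. At a pop, [x] has least rank among all socks left, so it
    can only be the last entry of a forbidden pattern; the other two then lie below it in the stack,
    which [dec] excludes. *)
Lemma foot_run_avoids rho s st o :
  foot_run s st o -> pairwise (fun x y => rho x <= rho y) o ->
  dec rho (rev st) /\ avoids rho (rev st ++ s).
Proof.
elim=> [_|x s' st' o' _ IH ho|x s' st' o' hr IH /= /andP[/allP hx ho]] //.
  have [d av] := IH ho; rewrite rev_cons cat_rcons in d av; split=> //.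
  by apply: dec_subseq d; apply: subseq_rcons.
have [d av] := IH ho; have memo := foot_run_mem hr.
have d' : dec rho (rev (x :: st')).
  move=> a b; rewrite rev_cons -cats1 subseq2_cat => /or3P[|/andP[ha]|].
  - exact: d.
  - by rewrite inE => /eqP->; apply: hx; rewrite memo mem_cat -mem_rev ha.
  - by move/size_subseq.
split=> // a b c; rewrite rev_cons cat_rcons subseq3_cat.
have hle y : y \in rev st' ++ s' -> rho x <= rho y.
  by rewrite mem_cat mem_rev => hy; apply: hx; rewrite memo mem_cat.
case/or4P => [h|/andP[hab]|/andP[ha]|] /=.
- by apply: av; rewrite subseq3_cat h.
- rewrite inE => /orP[/eqP->|hc]; last by apply: av; rewrite subseq3_cat hab hc orbT.
  by have := d _ _ hab; lia.
- case: eqP => [->|_] h; last by apply: av; rewrite subseq3_cat ha h !orbT.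
  by have := hle a; rewrite mem_cat ha => /(_ isT); lia.
- case: eqP => [->|_] h; last by apply: av; rewrite subseq3_cat h !orbT.
  have [_ hc] := subseq2_mem h.
  by have := hle c; rewrite mem_cat hc orbT => /(_ isT); lia.
Qed.

(** The run pops whenever no remaining input sock ranks below the top [x], and pushes otherwise. A
    push of [z] keeps the stack decreasing: some later [y] ranks below [x], so a stacked [a] ranking
    below [z] would give [rho y < rho x <= rho a < rho z], and [a z y] would be forbidden. *)
Lemma avoids_foot_run rho s st :
  dec rho (rev st) -> avoids rho (rev st ++ s) ->
  exists2 o, foot_run s st o & pairwise (fun x y => rho x <= rho y) o.
Proof.
(* An input sock counts twice and a stacked one once, so pushes and pops both lower the measure. *)
have [n] := ubnP ((size s).*2 + size st).
elim: n s st => // n IH s st hn d av.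
have push z s' : s = z :: s' -> dec rho (rev (z :: st)) ->
  exists2 o, foot_run s st o & pairwise (fun x y => rho x <= rho y) o.
  move=> def_s dz.
  have [|//||o ro po] := IH s' (z :: st); first by rewrite def_s /= in hn *; lia.
    by rewrite rev_cons cat_rcons -def_s.
  by exists o => //; rewrite def_s; apply: FootPush.
case: st => [|x st] in hn d av push *.
  case: s push {hn av} => [|z s] push; first by exists [::] => //; apply: FootDone.
  by apply: (push z s) => // a b /size_subseq.
have [/allP hall|/allPn[y ys hy]] := boolP (all (fun y => rho x <= rho y) s).
  have [|||o ro po] := IH s st; first by move: hn => /=; lia.
  - by apply: dec_subseq d; rewrite rev_cons subseq_rcons.
  - by apply: avoids_subseq av; rewrite rev_cons cat_rcons cat_subseq // subseq_cons.
  exists (x :: o); first exact: FootPop.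
  rewrite /= po andbT; apply/allP => y; rewrite (foot_run_mem ro) mem_cat.
  case/orP=> hy; last exact: hall.
  by apply: d; rewrite rev_cons -cats1 subseq2_cat mem_rev hy mem_seq1 eqxx orbT.
case: s => [//|z s] in hn av push ys *.
apply: (push z s) => // a b; rewrite rev_cons -cats1 subseq2_cat => /or3P[|/andP[ha]|].
- exact: d.
- rewrite inE => /eqP->; rewrite leqNgt; apply/negP => haz.
  have hxa : rho x <= rho a.
    move: ha; rewrite mem_rev inE => /orP[/eqP->//|ha].
    by apply: d; rewrite rev_cons -cats1 subseq2_cat mem_rev ha mem_seq1 eqxx orbT.
  have hys : y \in s.
    by move: ys hy; rewrite inE => /orP[/eqP->|//]; lia.
  have := av a z y; rewrite subseq3_cat ha /= eqxx sub1seq hys !orbT => /(_ isT).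
  by move: hy; lia.
- by move/size_subseq.
Qed.

Lemma foot_sortableE s : foot_sortable s <-> sortable_from [::] s.
Proof.
split=> [[o ro co]|[rho inj_rho [_ av]]].
  (* Colours are ranked by first occurrence in the output; absent ones go past all indices, which
     keeps [rho] injective on [nat]. *)
  pose rho c := if c \in o then index c o else size o + c.
  have inj_rho : injective rho.
    move=> a b; rewrite /rho; case: ifP => ha; case: ifP => hb.
    - by move=> e; rewrite -(nth_index 0 ha) e nth_index.
    - by move/idP: ha; rewrite -index_mem => lt e; rewrite e -ltn_subRL subnn in lt.
    - by move/idP: hb; rewrite -index_mem => lt e; rewrite -e -ltn_subRL subnn in lt.
    - by lia.
  have po : pairwise (fun x y => rho x <= rho y) o.
    apply/(pairwiseP 0) => i j; rewrite !inE => hi hj lij.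
    rewrite /rho !mem_nth // leqNgt; apply/negP => lt.
    (* The block of the colour at [j] starts before [i] and reaches [j], hence contains [i]. *)
    have eij : nth 0 o i = nth 0 o j.
      rewrite -[RHS](nth_index 0 (mem_nth 0 hj)).
      apply: (co 0 _ i j) => //.
      - by rewrite (leq_trans (ltnW lt)) // index_nth // (ltn_trans lij).
      - exact: ltnW.
      - by rewrite nth_index // mem_nth.
    by rewrite eij ltnn in lt.
  by exists rho => //; have := foot_run_avoids ro po.
have [//|o ro po] := @avoids_foot_run rho s [::] _ av.
exists o => // x0 i j k ij jk ko eik.
move/(pairwiseP x0): po => po; apply: inj_rho; apply/eqP.
have le a b : a <= b -> b < size o -> rho (nth x0 o a) <= rho (nth x0 o b).
  rewrite leq_eqVlt => /orP[/eqP->|ab hb]; first by [].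
  exact: po (ltn_trans ab hb) hb ab.
by rewrite eqn_leq {1}eik !le // (leq_ltn_trans jk).
Qed.

(** * Moves that preserve sortability *)

Definition first_rank (rho : nat -> nat) x y := if y == x then 0 else (rho y).+1.

Lemma first_rank_inj rho x : injective rho -> injective (first_rank rho x).
Proof.
move=> inj_rho a b; rewrite /first_rank.
by case: eqP => [->|_]; case: eqP => [->|_] // [/inj_rho].
Qed.

Lemma sortable_from_subseq u u' v v' :
  subseq u' u -> subseq (u' ++ v') (u ++ v) ->
  sortable_from u v -> sortable_from u' v'.
Proof.
move=> su sv [rho inj_rho [d av]]; exists rho => //; split.
  exact: dec_subseq su d.
exact: avoids_subseq sv av.
Qed.

Lemma sortable_from_push u v1 v2 :
  sortable_from (u ++ v1) v2 -> sortable_from u (v1 ++ v2).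
Proof. by apply: sortable_from_subseq; rewrite ?prefix_subseq // catA. Qed.

(** Rank [x] first. Having least rank, it can only be the last entry of a forbidden pattern; as [x]
    does not occur in [v2], the other two entries then lie in the part that becomes frozen, where
    ranks decrease. *)
Lemma sortable_from_choose x u v1 v2 :
  (forall b, subseq [:: x; b] u -> b = x) -> x \notin v2 ->
  sortable_from (filter (predC1 x) (u ++ v1)) v2 -> sortable_from u (v1 ++ v2).
Proof.
move=> hu hx [rho inj_rho [d av]]; exists (first_rank rho x); first exact: first_rank_inj.
split=> [a b hab|a b c]; rewrite /first_rank.
  case: (eqVneq b x) => // nbx; case: (eqVneq a x) hab => [-> /hu|nax hab].
    by move/eqP: nbx.
  apply: d; rewrite filter_cat; apply: subseq_trans (prefix_subseq _ _).
  by rewrite subseq_filter hab /= nax nbx.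
case: (eqVneq a x) => [->|nax] h; first by rewrite ltn0.
case: (eqVneq b x) h => [->|nbx] h; first by rewrite ltn0 andbF.
case: (eqVneq c x) h => [->|ncx] h.
  move: h; rewrite catA => /(@subseq_rcons_last _ _ [:: a; b]) /(_ hx) h.
  rewrite ltnS ltnS -leqNgt; apply: d.
  rewrite subseq_filter /= nax nbx /=; apply: subseq_trans h.
  exact: (prefix_subseq [:: a; b]).
rewrite !ltnS; apply: av; move: h; rewrite catA => h.
have -> : v2 = filter (predC1 x) v2.
  by apply/esym/all_filterP/allP => y; apply: contraTneq => ->.
by rewrite -filter_cat subseq_filter /= nax nbx ncx.
Qed.

Lemma sortable_from_pop u f v : f \notin u -> f \notin v ->
  sortable_from (rcons u f) v <-> sortable_from u v.
Proof.
move=> fu fv; split.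
  apply: sortable_from_subseq; rewrite ?subseq_rcons // cat_rcons.
  by rewrite cat_subseq // subseq_cons.
move=> h; apply: (@sortable_from_choose f (rcons u f) [::] v) => //.
  move=> b; rewrite -cats1 subseq2_cat => /or3P[|/andP[]|/size_subseq//].
    by case/subseq2_mem; rewrite (negbTE fu).
  by rewrite (negbTE fu).
rewrite cats0 filter_rcons /= eqxx /= (_ : filter _ _ = u) //.
by apply/all_filterP/allP => y; apply: contraTneq => ->.
Qed.

(** Push [t] colour by colour and pop each finished one as soon as it is pushed; distinctness
    ensures that it is then the only sock of its colour. *)
Lemma sortable_from_pops (P : pred nat) u t w :
  uniq (u ++ t) -> {in t, forall c, ~~ P c -> c \notin w} ->
  sortable_from (u ++ filter P t) w -> sortable_from u (t ++ w).
Proof.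
elim: t u => [|c t IH] u /=; first by rewrite cats0.
move=> ut hP; have hP' : {in t, forall c, ~~ P c -> c \notin w}.
  by move=> y yt; apply: hP; rewrite inE yt orbT.
have ucat : uniq (rcons u c ++ t) by rewrite cat_rcons.
have usub : uniq (u ++ t).
  by apply: subseq_uniq ut; rewrite cat_subseq // subseq_cons.
case: ifP => [_|/negbT nPc] h.
  have := IH (rcons u c) ucat hP'; rewrite cat_rcons => /(_ h).
  by rewrite -cats1 => /sortable_from_push.
rewrite -cat1s; apply: sortable_from_push; rewrite cats1.
move: ut; rewrite cat_uniq /= negb_or => /and3P[_ /andP[cu _] /andP[ct _]].
apply/sortable_from_pop => //; last exact: IH.
by rewrite mem_cat (negbTE ct) hP // mem_head.
Qed.

Lemma sortable_from_stutter A y l v : 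
  sortable_from (rcons A y ++ y :: l) v <-> sortable_from (rcons A y ++ l) v.
Proof.
split; first by apply: sortable_from_subseq; rewrite -?catA cat_subseq ?subseq_cons.
case=> rho inj_rho [d av]; exists rho => //; split.
  move=> a b; case: (eqVneq a b) => [->//|nab] h; apply: d; move: h.
  by rewrite !cat_rcons => /subseq_stutter; apply; rewrite /= nab.
move=> a b c h; apply/negP => /andP[ca ab].
suff h' : subseq [:: a; b; c] ((rcons A y ++ l) ++ v) by have := av _ _ _ h'; rewrite ca ab.
have nab : a != b by apply: contraTneq ab => ->; rewrite ltnn.
have nbc : b != c by apply: contraTneq (ltn_trans ca ab) => ->; rewrite ltnn.
move: h; rewrite -!catA !cat_rcons => /subseq_stutter.
by apply; rewrite /= nab nbc.
Qed.

(** * Colours that can leave next *)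

(* [x] is the colour that leaves first among those of the remaining input [w], and
   the next sock [z] is buried under [g]. *)
Section Conflict.

Variables (rho : nat -> nat) (u t p g w' : seq nat) (z x : nat).
Hypotheses (inj_rho : injective rho) (dec_u : dec rho u).
Let w := z :: w'.
Hypotheses (av : avoids rho (u ++ t ++ w)) (def_ut : u ++ t = p ++ z :: g).
Hypotheses (uniq_ut : uniq (u ++ t)).
Hypothesis top_alive : forall u1 c, u = rcons u1 c -> c \in w.
Hypotheses (xw : x \in w) (min_x : {in w, forall y, rho x <= rho y}).

Let uniq_pzg : uniq (p ++ z :: g). Proof. by rewrite -def_ut. Qed.

Let pz : z \notin p.
Proof.
by move: uniq_pzg; rewrite cat_uniq /= negb_or => /and3P[_ /andP[]].
Qed.

Let gz : z \notin g.
Proof. by move: uniq_pzg; rewrite cat_uniq /= => /and4P[]. Qed.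

Let pg a : a \in p -> a \notin g.
Proof.
move=> ap; apply/negP => ag; move: uniq_pzg; rewrite cat_uniq /= negb_or.
by case/and3P=> _ /andP[_ /hasPn/(_ _ ag)]; rewrite ap.
Qed.

Let no a b c : subseq [:: a; b; c] (p ++ z :: g ++ w) ->
  rho c < rho a -> rho a < rho b -> False.
Proof.
move=> h ca ab; have := av; rewrite catA def_ut -catA => /(_ a b c h).
by rewrite ca ab.
Qed.

Let neq a b : a != b -> (rho a < rho b) || (rho b < rho a).
Proof. by move=> nab; rewrite -neq_ltn; apply: contraNneq nab => /inj_rho ->. Qed.

(** The top of [u] is unfinished, hence ranks at least as high as [x], and the socks below it in [u]
    rank at least as high as the top. *)
Lemma rank_min_le a : a \in u ++ w -> rho x <= rho a.
Proof.
rewrite mem_cat => /orP[|/min_x//]; case: (lastP u) dec_u top_alive => // u1 c d.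
move=> /(_ u1 c erefl) cw; rewrite mem_rcons inE => /orP[/eqP->|au]; first exact: min_x.
apply: leq_trans (min_x cw) (d _ _ _).
by rewrite -cats1 subseq2_cat au mem_seq1 eqxx orbT.
Qed.

(** If [x] is not [z], it occurs after the incoming [z] and ranks below it. A [y] above [z] with
    rank above [x] would then make [y z x] or [z y x] forbidden, according to the order of [y] and
    [z]. So only [x] can be both unfinished and above [z]. *)
Lemma rank_above_le y : x != z -> y \in g -> rho y <= rho x.
Proof.
move=> xz yg; have zw : z \in w by rewrite mem_head.
have xw' : x \in w' by move: xw; rewrite inE (negbTE xz).
have ltxz : rho x < rho z by have := neq xz; have := min_x zw; lia.
rewrite leqNgt; apply/negP => ltxy; have yz : y != z by apply: contraNneq gz => <-.
have /orP[yz'|zy'] := neq yz.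
  apply: (@no y z x) => //; rewrite -(cat1s z) catA; apply: subseq_trans (suffix_subseq _ _).
  rewrite (_ : [:: y; z; x] = [:: y] ++ [:: z] ++ [:: x]) //.
  by rewrite cat_subseq ?sub1seq // /w /= eqxx sub1seq.
apply: (@no z y x) => //; apply: subseq_trans (suffix_subseq _ _); rewrite /= eqxx.
rewrite (_ : [:: y; x] = [:: y] ++ [:: x]) //.
by rewrite cat_subseq ?sub1seq.
Qed.

(** Suppose [a] lies below [b] and ranks below it. Nothing in [g ++ w] can then rank below [a],
    which forces [x = a]. So [x] is not [z], and every [y] in the nonempty [g] ranks strictly below
    [a], a contradiction. *)
Lemma conflict_dec p' : g != [::] -> subseq p' p -> {subset p' <= u ++ w} ->
  dec rho (rcons p' z).
Proof.
move=> g0 pp' p'u a b hab; have [ab|ba] := eqVneq a b; first by rewrite ab.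
have hab' : subseq [:: a; b] (rcons p z).
  by apply: subseq_trans hab _; rewrite -!cats1 cat_subseq.
have ap' : a \in p'.
  move: hab; rewrite -cats1 subseq2_cat => /or3P[/subseq2_mem[]|/andP[]|/size_subseq]//.
have ap := mem_subseq pp' ap'; have az : a != z by apply: contraNneq pz => <-.
rewrite leqNgt; apply/negP => ltab.
have no' c : c \in g ++ w -> rho c < rho a -> False.
  move=> cw lt; apply: (@no a b c _ lt ltab); rewrite -cat_rcons.
  by rewrite (_ : [:: a; b; c] = [:: a; b] ++ [:: c]) // cat_subseq ?sub1seq.
have lexa : rho x <= rho a by apply: rank_min_le; apply: p'u.
have xa : x = a.
  apply/eqP; apply/negPn/negP => /neq xa; apply: (no' x); last by lia.
  by rewrite mem_cat xw orbT.
have xz : x != z by rewrite xa.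
have [y yg] : exists y, y \in g by case: (g) g0 => // y g' _; exists y; rewrite mem_head.
have le := rank_above_le xz yg.
have ya : y != a by apply: contraTneq yg => ->; apply: pg.
apply: (no' y); first by rewrite mem_cat yg.
by have := neq ya; rewrite -xa; lia.
Qed.

(** If [a] precedes [b] and ranks below it, the last [z] after them forces [a] to rank below
    [z = x]. Then [a] is not in [u ++ w], so it can only lie in [ge], and [z e a] is forbidden. *)
Lemma choose_below_dec p' gf e ge v0 v2 : g = gf ++ e :: ge -> x = z -> e \in w ->
  subseq p' p -> {subset p' <= u ++ w} -> w = rcons v0 z ++ v2 ->
  dec rho (filter (predC1 z) (p' ++ z :: e :: ge ++ rcons v0 z)).
Proof.
move=> def_g xz ew pp' p'u def_w a b.
rewrite subseq_filter /= andbT => /andP[/andP[az bz] hab].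
rewrite leqNgt; apply/negP => ltab.
have hab' : subseq [:: a; b] (p' ++ z :: e :: ge ++ v0).
  have : subseq [:: a; b] (filter (predC1 z) (p' ++ z :: e :: ge ++ rcons v0 z)).
    by rewrite subseq_filter /= az bz.
  have -> : p' ++ z :: e :: ge ++ rcons v0 z = rcons (p' ++ z :: e :: ge ++ v0) z.
    by rewrite rcons_cat /= rcons_cat.
  rewrite filter_rcons /= eqxx /=.
  by rewrite subseq_filter => /andP[].
have /no no' : subseq [:: a; b; z] (p ++ z :: g ++ w).
  rewrite (_ : [:: a; b; z] = [:: a; b] ++ [:: z]) //.
  rewrite def_w def_g cat_rcons.
  have -> : p ++ z :: (gf ++ e :: ge) ++ v0 ++ z :: v2 =
    (p ++ z :: (gf ++ e :: ge) ++ v0) ++ z :: v2 by rewrite -?catA /= -?catA /= -?catA.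
  apply: cat_subseq; last by rewrite sub1seq mem_head.
  apply: subseq_trans hab' _; apply: cat_subseq => //=; rewrite eqxx -catA.
  exact: suffix_subseq.
have ltaz : rho a < rho z by have := neq az; case: ltngtP => // za _; case: no'.
have aw : a \notin u ++ w.
  by apply: contraL ltaz => /rank_min_le; rewrite -leqNgt xz.
have zw : z \in w by rewrite mem_head.
have := mem_subseq hab (mem_head _ _); rewrite !(mem_cat, inE) mem_rcons inE.
rewrite (negbTE az) /= => /or4P[/p'u ap|/eqP ae|ag|av0].
- by rewrite ap in aw.
- by move: aw; rewrite mem_cat ae ew orbT.
- have ez : z != e by apply: contraNneq gz => ->; rewrite def_g mem_cat mem_head orbT.
  apply: (@no z e a) => //; last first.
    by have := neq ez; have := min_x ew; rewrite xz; case: ltngtP.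
  apply: subseq_trans (suffix_subseq _ _); rewrite /= eqxx def_g -catA.
  apply: subseq_trans (suffix_subseq _ _); rewrite /= eqxx sub1seq mem_cat.
  by rewrite ag.
- by move: aw; rewrite !mem_cat def_w !mem_cat mem_rcons inE av0 !orbT.
Qed.

(** The last [e] plays the part of the third entry: an ascent from [a] to [b] before it would make
    [a] rank below [e = x], although [a] lies in [u ++ w]. *)
Lemma choose_above_dec p' e v0 v2 : x = e -> e \in g ->
  subseq p' p -> {subset p' <= u ++ w} -> w = rcons v0 e ++ v2 ->
  dec rho (filter (predC1 e) (rcons (rcons p' z) e ++ rcons v0 e)).
Proof.
move=> xe eg pp' p'u def_w a b.
have ez : e != z by apply: contraNneq gz => <-.
rewrite subseq_filter /= andbT => /andP[/andP[ae be] hab].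
rewrite leqNgt; apply/negP => ltab.
have hab' : subseq [:: a; b] (rcons p' z ++ v0).
  have : subseq [:: a; b] (filter (predC1 e) (rcons (rcons p' z) e ++ rcons v0 e)).
    by rewrite subseq_filter /= ae be.
  rewrite filter_cat !filter_rcons /= eqxx /= -filter_rcons -filter_cat.
  by rewrite subseq_filter => /andP[].
have /no no' : subseq [:: a; b; e] (p ++ z :: g ++ w).
  rewrite (_ : [:: a; b; e] = [:: a; b] ++ [:: e]) //.
  rewrite def_w cat_rcons.
  have -> : p ++ z :: g ++ v0 ++ e :: v2 = (rcons p z ++ g ++ v0) ++ e :: v2.
    by rewrite cat_rcons -?catA /= -?catA /= -?catA.
  apply: cat_subseq; last by rewrite sub1seq mem_head.
  apply: subseq_trans hab' _; apply: cat_subseq; last exact: suffix_subseq.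
  by rewrite -!cats1 cat_subseq.
have ltae : rho a < rho e by have := neq ae; case: ltngtP => // za _; case: no'.
have : a \in u ++ w.
  have := mem_subseq hab' (mem_head _ _).
  rewrite mem_cat mem_rcons inE => /orP[/orP[/eqP->|/p'u//]|av0].
    by rewrite mem_cat mem_head orbT.
  by rewrite def_w !mem_cat mem_rcons inE av0 !orbT.
by move/rank_min_le; rewrite xe leqNgt ltae.
Qed.

End Conflict.

(** * Safety of the greedy decisions *)

Lemma exists_rank_min (rho : nat -> nat) (w : seq nat) : w != [::] ->
  exists2 x, x \in w & {in w, forall y, rho x <= rho y}.
Proof.
elim: w => [//|a w IH] _; have [->|/IH[x xw min_x]] := eqVneq w [::].
  by exists a => [|y]; rewrite inE // => /eqP->.
have [le|lt] := leqP (rho a) (rho x).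
  exists a => [|y]; first exact: mem_head.
  by rewrite inE => /orP[/eqP->//|/min_x]; apply: leq_trans.
exists x => [|y]; first by rewrite inE xw orbT.
by rewrite inE => /orP[/eqP->|/min_x//]; exact: ltnW.
Qed.

Lemma sortable_from_pop_tail u g v : uniq (u ++ g) -> {in g, forall c, c \notin v} ->
  sortable_from (u ++ g) v <-> sortable_from u v.
Proof.
elim/last_ind: g => [|g c IH]; first by rewrite cats0.
rewrite -rcons_cat rcons_uniq => /andP[cug uug] gv.
have cv : c \notin v by apply: gv; rewrite mem_rcons mem_head.
apply: iff_trans (sortable_from_pop cug cv) (IH uug _) => y yg.
by apply: gv; rewrite mem_rcons inE yg orbT.
Qed.

(* [u] is committed, [t] is not, [z :: w'] is the remaining input, and [z] is buried
   under [g]. *)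
Section Event.

Variables (u t p g w' : seq nat) (z : nat).
Let w := z :: w'.
Hypotheses (def_ut : u ++ t = p ++ z :: g) (uniq_ut : uniq (u ++ t)).
Hypothesis top_alive : forall u1 c, u = rcons u1 c -> c \in w.

Let uniq_pzg : uniq (p ++ z :: g). Proof. by rewrite -def_ut. Qed.

Let g_notin c : c \in g -> (c != z) && (c \notin p).
Proof.
move=> cg; move: uniq_pzg; rewrite cat_uniq /= negb_or.
case/and4P=> _ /andP[_ /hasPn/(_ _ cg) ->] zg _; rewrite andbT.
by apply: contraNneq zg => <-.
Qed.

(** Either [z] is the top of [u] and nothing below it is filtered, or [z] lies in the uncommitted
    part and [p'] is [u] followed by the unfinished colours between [u] and [z]. The stack is
    allowed to stop at [t1] and [g1] because a choice of [z] filters only below [e]. *)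
Lemma conflict_kept (t1 g1 : seq nat) : u ++ t1 = p ++ z :: g1 -> size u <= (size p).+1 ->
  exists2 p', u ++ filter (mem w) t1 = rcons p' z ++ filter (mem w) g1
            & subseq p' p /\ {subset p' <= u ++ w}.
Proof.
move=> def_ut1 nondeep; have [lt|le] := ltnP (size p) (size u).
  have su : size u = size (rcons p z) by rewrite size_rcons; apply/eqP; rewrite eqn_leq nondeep.
  move/eqP: def_ut1; rewrite -cat_rcons eqseq_cat // => /andP[/eqP-> /eqP->].
  exists p => //; split=> // y yp; by rewrite mem_cat mem_rcons inE yp orbT.
have def_p : p = u ++ drop (size u) p.
  rewrite -{1}(cat_take_drop (size u) p); congr (_ ++ _).
  have := congr1 (take (size u)) def_ut1; rewrite take_size_cat // take_cat.
  case: ltnP => // ge; rewrite (_ : size u = size p) ?subnn ?take0 ?cats0 ?take_size //.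
  by apply/eqP; rewrite eqn_leq le.
have def_t1 : t1 = drop (size u) p ++ z :: g1.
  by move/eqP: def_ut1; rewrite {1}def_p -catA eqseq_cat // eqxx => /eqP.
exists (u ++ filter (mem w) (drop (size u) p)).
  by rewrite def_t1 filter_cat /= mem_head cat_rcons -catA.
split; first by rewrite {2}def_p cat_subseq // filter_subseq.
by move=> y; rewrite !mem_cat mem_filter => /orP[->//|/andP[/= ->]]; rewrite orbT.
Qed.

Lemma deep_split : (size p).+1 < size u -> exists g1 c,
  u = p ++ z :: rcons g1 c /\ g = rcons g1 c ++ t.
Proof.
move=> deep; have su : size (take (size p).+1 u) = size (rcons p z).
  by rewrite size_rcons size_takel // ltnW.
have := def_ut; rewrite -{1}(cat_take_drop (size p).+1 u) -catA -cat_rcons => /eqP.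
rewrite eqseq_cat // => /andP[/eqP tk /eqP dr].
have := size_drop (size p).+1 u; case: (lastP (drop _ u)) (cat_take_drop (size p).+1 u) dr.
  by move=> _ _ /=; lia.
by move=> g1 c def_u <- _; exists g1, c; rewrite -def_u tk cat_rcons.
Qed.

(** Once the finished [g] is gone, the stack ends with [z], and [conflict_dec] shows that every
    ranking already decreases on it. *)
Lemma event_pop : g != [::] -> size u <= (size p).+1 -> {in g, forall c, c \notin w} ->
  sortable_from u (t ++ w) <-> sortable_from (u ++ filter (mem w) t) w.
Proof.
move=> g0 nondeep deadg; split; last first.
  by apply: sortable_from_pops => // c _; rewrite /= => ->.
have [p' -> [pp' p'u]] := conflict_kept def_ut nondeep.
have -> : filter (mem w) g = [::].
  by apply/eqP; rewrite -[_ == _]negbK -has_filter; apply/hasPn => y /deadg.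
rewrite cats0 => -[rho inj_rho [d av]]; exists rho => //.
have [//|x xw min_x] := @exists_rank_min rho w.
split; first exact: (conflict_dec inj_rho d av def_ut uniq_ut top_alive xw min_x).
apply: avoids_subseq av; rewrite catA def_ut cat_subseq // -cats1 cat_subseq //.
by rewrite sub1seq mem_head.
Qed.

(* With a single unfinished colour [e] above [z], the last hypothesis makes letting [z]
   leave first harmless: the socks up to the last one of [z] are then all [z] or [e]. *)
Lemma event_choose_below t1 gf e ge v0 v2 :
  t = t1 ++ e :: ge -> g = gf ++ e :: ge -> {in gf, forall c, c \notin w} -> e \in w ->
  size u <= (size p).+1 -> w = rcons v0 z ++ v2 -> z \notin v2 ->
  has (mem w) ge \/ (e \in v2) && ((ge == [::]) || (e \notin v0)) ->
  sortable_from u (t ++ w) <->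
  sortable_from (filter (predC1 z) (u ++ filter (mem w) t1 ++ e :: ge ++ rcons v0 z)) v2.
Proof.
move=> def_t def_g deadgf ew nondeep def_w zv2 hC.
have def_ut1 : u ++ t1 = p ++ z :: gf.
  have := def_ut; rewrite def_t def_g catA -cat_cons catA => /eqP.
  rewrite eqseq_cat ?eqxx ?andbT; first by move/eqP.
  by have := congr1 size def_ut; rewrite def_t def_g !size_cat /= !size_cat /=; lia.
have [p' def_p' [pp' p'u]] := conflict_kept def_ut1 nondeep.
have deadf : filter (mem w) gf = [::].
  by apply/eqP; rewrite -[_ == _]negbK -has_filter; apply/hasPn => y /deadgf.
rewrite deadf cats0 in def_p'.
have uz : forall b, subseq [:: z; b] (rcons p' z) -> b = z.
  have zp' : z \notin p'.
    apply/negP => /(mem_subseq pp'); move: uniq_pzg; rewrite cat_uniq /= negb_or.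
    by case/and3P => _ /andP[/negbTE->].
  move=> b; rewrite -cats1 subseq2_cat => /or3P[/subseq2_mem[]|/andP[]|/size_subseq//];
  by rewrite (negbTE zp').
rewrite catA def_p'; split=> [|h]; last first.
  rewrite def_t -catA; apply: (@sortable_from_pops (mem w)) => //.
  - by apply: subseq_uniq uniq_ut; rewrite def_t catA prefix_subseq.
  - move=> c ct1 /= cw; rewrite -cat_cons mem_cat negb_or cw andbT.
    move: uniq_ut; rewrite def_t catA cat_uniq => /and3P[_ /hasPn h' _].
    by apply/negP => /h'; rewrite /= mem_cat ct1 orbT.
  - rewrite def_p' def_w [X in sortable_from _ X]catA.
    by apply: (sortable_from_choose uz zv2); exact: h.
move=> -[rho inj_rho [d av]].
have [//|x xw min_x] := @exists_rank_min rho w.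
have sub : subseq (filter (predC1 z) (rcons p' z ++ e :: ge ++ rcons v0 z) ++ v2) (u ++ t ++ w).
  have -> : u ++ t ++ w = (rcons p z ++ g ++ rcons v0 z) ++ v2.
    by rewrite catA def_ut def_w -cat_rcons -!catA.
  rewrite cat_subseq //; apply: subseq_trans (filter_subseq _ _) _.
  rewrite cat_subseq ?def_g -?cats1 ?cat_subseq // -catA.
  exact: suffix_subseq.
have [xz|nxz] := eqVneq x z.
  exists rho => //; split; last exact: avoids_subseq av.
  rewrite cat_rcons.
  exact: (choose_below_dec inj_rho d av def_ut uniq_ut top_alive min_x def_g xz ew pp' p'u def_w).
(* From here on [x] is not [z], so it is [e], the only unfinished colour of [g]; the same ranking is
   shown to survive the choice of [z] all the same. *)
have le_x y : y \in g -> rho y <= rho x.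
  by apply: (rank_above_le inj_rho av def_ut uniq_ut xw min_x).
have alive_x y : y \in g -> y \in w -> y = x.
  by move=> yg yw; apply: (inj_rho); apply/eqP; rewrite eqn_leq le_x // min_x.
have ex : e = x by apply: alive_x => //; rewrite def_g mem_cat mem_head orbT.
have ege : e \notin ge.
  by move: uniq_pzg; rewrite def_g !cat_uniq /= => /and4P[_ _ _]; rewrite cat_uniq /= => /and4P[].
have deadge y : y \in ge -> y \notin w.
  move=> yge; apply/negP => yw; move: ege; rewrite ex -(alive_x y) ?yge //.
  by rewrite def_g mem_cat inE yge !orbT.
case: hC => [/hasP[y /deadge/negP]//|/andP[ev2 hC]].
have p'x a : a \in p' -> rho x <= rho a.
  by move/p'u; apply: (rank_min_le d top_alive min_x).
have dp' : dec rho (rcons p' z).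
  apply: (conflict_dec inj_rho d av def_ut uniq_ut top_alive xw min_x) => //.
  by rewrite def_g; case: (gf).
have dpe k : dec rho (p' ++ nseq k e).
  move=> a b; rewrite subseq2_cat => /or3P[h|/andP[ap]|].
  - by apply: dp'; apply: subseq_trans h (subseq_rcons _ _).
  - by rewrite mem_nseq => /andP[_ /eqP->]; rewrite ex; apply: p'x.
  - by case/subseq2_mem; rewrite !mem_nseq => /andP[_ /eqP->] /andP[_ /eqP->].
have no a b c : subseq [:: a; b; c] (u ++ t ++ w) -> rho c < rho a -> rho a < rho b -> False.
  by move=> /av h ca ab; rewrite ca ab in h.
have ltx y : y \in w -> y != x -> rho x < rho y.
  by move=> yw yx; rewrite ltn_neqAle min_x // andbT; apply: contraNneq yx => /inj_rho->.
(* A third colour [y] before the last [z] would make [y z e] or [z y e] forbidden, as [e = x] comes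
   back in [v2]. *)
have v0ze y : y \in v0 -> y != z -> y = e.
  move=> yv0 yz; apply/eqP; rewrite ex; apply/negPn/negP => yx.
  have yw : y \in w by rewrite def_w mem_cat mem_rcons inE yv0 orbT.
  have ltxz : rho x < rho z by apply: ltx; rewrite ?mem_head // eq_sym.
  have ltxy := ltx _ yw yx.
  have [ltyz|ltzy|/inj_rho eyz] := ltngtP (rho y) (rho z); last by rewrite eyz eqxx in yz.
    apply: (no y z x) => //; rewrite -ex catA def_w.
    apply: subseq_trans (suffix_subseq _ _).
    rewrite (_ : [:: y; z; e] = [:: y; z] ++ [:: e]) // cat_subseq ?sub1seq //.
    by rewrite -cats1 (_ : [:: y; z] = [:: y] ++ [:: z]) // cat_subseq ?sub1seq ?mem_head.
  apply: (no z y x) => //; rewrite -ex catA def_w.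
  rewrite (_ : [:: z; y; e] = [:: z] ++ [:: y] ++ [:: e]) //.
  rewrite !cat_subseq ?sub1seq //; first by rewrite def_ut mem_cat mem_head orbT.
  by rewrite mem_rcons inE yv0 orbT.
have def_L : filter (predC1 z) (rcons p' z ++ e :: ge ++ rcons v0 z)
    = p' ++ e :: ge ++ filter (predC1 z) v0.
  have filter_id l : z \notin l -> filter (predC1 z) l = l.
    by move=> zl; apply/all_filterP/allP => y; apply: contraTneq => ->.
  have zg : z \notin g by apply/negP => /g_notin; rewrite eqxx.
  have zp' : z \notin p'.
    apply/negP => /(mem_subseq pp'); move: uniq_pzg; rewrite cat_uniq /= negb_or.
    by case/and3P => _ /andP[/negbTE->].
  have : z \notin e :: ge by apply: contra zg; rewrite def_g mem_cat => ->; rewrite orbT.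
  move/filter_id; rewrite -!cat_cons !filter_cat !filter_rcons [predC1 z z]/= eqxx /=.
  by move=> ->; rewrite (filter_id p').
have e_v0 : filter (predC1 z) v0 = nseq (size (filter (predC1 z) v0)) e.
  apply/all_pred1P/allP => y; rewrite mem_filter => /andP[yz yv0].
  by rewrite /= (v0ze y yv0 yz).
(* What stays is [p'], then copies of [e], with the finished [ge] after the first copy. Either [ge]
   is empty, or no further [e] follows and [ge] can be popped from the top. *)
move: sub; rewrite def_L; case/orP: hC => [/eqP ge0|ev0] sub.
  exists rho => //; split; last exact: avoids_subseq sub av.
  by rewrite ge0 cat0s e_v0; apply: (dpe _.+1).
have v0_nil : filter (predC1 z) v0 = [::].
  apply/eqP; rewrite -[_ == _]negbK -has_filter; apply/hasPn => y yv0 /=.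
  by rewrite negbK; apply: contraNT ev0 => /(v0ze y yv0) <-.
move: sub; rewrite v0_nil cats0 -cat1s catA => sub.
apply/sortable_from_pop_tail.
- have : subseq ((p' ++ [:: e]) ++ ge) (p ++ g).
    by rewrite -catA cat_subseq // def_g suffix_subseq.
  move/subseq_uniq; apply; apply: subseq_uniq uniq_pzg.
  by rewrite cat_subseq // subseq_cons.
- by move=> y /deadge; rewrite def_w mem_cat negb_or => /andP[].
exists rho => //; split; first exact: (dpe 1).
apply: avoids_subseq av; apply: subseq_trans sub.
by rewrite cat_subseq // prefix_subseq.
Qed.

(** If [x] is not [z], it is [e]. Suppose [x = z]. If [z] is deep, the unfinished top of [u] would
    have to leave before [z]. If [e] ends first, only [z] and [e] occur up to its last sock, and the
    same ranking still fits. In the third case the top [g0] of the stack is finished and has no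
    possible rank: [z e g0], [g0 e z] or [e g0 z] is forbidden, according to its place relative to
    [z] and [e]. *)
Lemma event_choose_above p' e v0 v2 :
  u ++ filter (mem w) t = rcons (rcons p' z) e -> subseq p' p -> {subset p' <= u ++ w} ->
  filter (mem w) g = [:: e] -> w = rcons v0 e ++ v2 -> e \notin v2 ->
  [\/ (size p).+1 < size u, z \in v2
    | last e g != e /\ exists v0' v2', w = rcons v0' z ++ v2' /\ e \in v0'] ->
  sortable_from u (t ++ w) <->
  sortable_from (filter (predC1 e) (u ++ filter (mem w) t ++ rcons v0 e)) v2.
Proof.
move=> def_st pp' p'u deadg def_w ev2 hC.
have eg_w : (e \in g) && (e \in w).
  by rewrite andbC -(mem_filter (mem w)) deadg mem_head.
have [eg ew] := andP eg_w; have /andP[ez ep] := g_notin eg.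
have dead_g y : y \in g -> y \in w -> y = e.
  by move=> yg yw; apply/eqP; rewrite -mem_seq1 -deadg mem_filter /= yw.
rewrite catA def_st; split=> [|h]; last first.
  apply: (@sortable_from_pops (mem w)) => //.
  rewrite def_st def_w; apply: (sortable_from_choose _ ev2); last exact: h.
  have ep' : e \notin rcons p' z.
    by rewrite mem_rcons inE negb_or ez; apply/negP => /(mem_subseq pp'); apply/negP.
  move=> b; rewrite -cats1 subseq2_cat => /or3P[/subseq2_mem[]|/andP[]|/size_subseq//];
  by rewrite (negbTE ep').
move=> -[rho inj_rho [d av]].
have [//|x xw min_x] := @exists_rank_min rho w.
have zw : z \in w by rewrite mem_head.
have no a b c : subseq [:: a; b; c] (u ++ t ++ w) -> rho c < rho a -> rho a < rho b -> False.
  by move=> /av h ca ab; rewrite ca ab in h.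
exists rho => //; split; last first.
  apply: avoids_subseq av; rewrite catA def_ut def_w -cat_rcons -!catA catA catA cat_subseq //.
  apply: subseq_trans (filter_subseq _ _) _; rewrite cat_subseq //.
  by rewrite -cats1 cat_subseq ?sub1seq // -!cats1 cat_subseq.
have [xz|nxz] := eqVneq x z; last first.
  have xe : x = e.
    apply: (inj_rho); apply/eqP; rewrite eqn_leq min_x //=.
    exact: (rank_above_le inj_rho av def_ut uniq_ut xw min_x).
  exact: (choose_above_dec inj_rho d av def_ut uniq_ut top_alive min_x xe eg pp' p'u def_w).
have ltz y : y \in w -> y != z -> rho z < rho y.
  move=> yw yz; rewrite ltn_neqAle -{2}xz min_x // andbT.
  by apply: contraNneq yz => /inj_rho->.
case: hC => [deep|zv2|[last_g [v0' [v2' [def_w' ev0']]]]].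
- have [g1 [c [def_u def_g]]] := deep_split deep.
  have cw : c \in w by apply: (top_alive (u1 := p ++ z :: g1)); rewrite def_u rcons_cat.
  have cg : c \in g by rewrite def_g mem_cat mem_rcons mem_head.
  have : rho c <= rho z.
    apply: d; rewrite def_u; apply: subseq_trans (suffix_subseq _ _).
    by rewrite /= eqxx -cats1 sub1seq mem_cat mem_head orbT.
  by rewrite leqNgt ltz //; have /andP[] := g_notin cg.
- have v0ze y : y \in v0 -> y != e -> y = z.
    move=> yv0 ye; apply/eqP/negPn/negP => yz.
    have yw : y \in w by rewrite def_w mem_cat mem_rcons inE yv0 orbT.
    have [ltye|ltey|/inj_rho eye] := ltngtP (rho y) (rho e); last by rewrite eye eqxx in ye.
      apply: (no y e z); [|exact: ltz..|by []].
      rewrite catA def_w; apply: subseq_trans (suffix_subseq _ _).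
      rewrite (_ : [:: y; e; z] = [:: y; e] ++ [:: z]) // cat_subseq ?sub1seq //.
      by rewrite -cats1 (_ : [:: y; e] = [:: y] ++ [:: e]) // cat_subseq ?sub1seq ?mem_head.
    apply: (no e y z); [|exact: ltz|by []].
    rewrite catA def_w def_ut (_ : [:: e; y; z] = [:: e] ++ [:: y] ++ [:: z]) //.
    rewrite !cat_subseq ?sub1seq //; first by rewrite mem_cat inE eg !orbT.
    by rewrite mem_rcons inE yv0 orbT.
  have dp' : dec rho (rcons p' z).
    apply: (conflict_dec inj_rho d av def_ut uniq_ut top_alive xw min_x) => //.
    by case: (g) eg.
  have v0_z : filter (predC1 e) v0 = nseq (size (filter (predC1 e) v0)) z.
    apply/all_pred1P/allP => y; rewrite mem_filter => /andP[ye yv0].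
    by rewrite /= (v0ze y yv0 ye).
  rewrite filter_cat !filter_rcons /= eqxx /= eq_sym ez v0_z.
  move=> a b; rewrite cat_rcons -[z :: nseq _ z]/(nseq _.+1 z) subseq2_cat.
  case/or3P=> [h|/andP[ap]|].
  - apply: dp'; apply: subseq_trans h _; apply: subseq_trans (subseq_rcons _ _).
    exact: filter_subseq.
  - rewrite mem_nseq => /andP[_ /eqP->]; apply: dp'.
    rewrite -cats1 (_ : [:: a; z] = [:: a] ++ [:: z]) // cat_subseq ?sub1seq ?mem_head //.
    by move: ap; rewrite mem_filter => /andP[].
  - by case/subseq2_mem; rewrite !mem_nseq => /andP[_ /eqP->] /andP[_ /eqP->].
- exfalso; move: last_g eg def_ut uniq_pzg g_notin; case: (lastP g) => [//|g' g0].
  rewrite last_rcons mem_rcons inE eq_sym => /negbTE g0e; rewrite g0e /= => eg' def_ut' _ h.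
  have /andP[g0z _] := h g0 ltac:(by rewrite mem_rcons mem_head).
  have zutw : z \in w by [].
  have ltze := ltz _ ew ez.
  have [lt0z|ltz0|/inj_rho e0] := ltngtP (rho g0) (rho z); last by rewrite e0 eqxx in g0z.
    apply: (no z e g0) => //; rewrite catA def_ut'.
    apply: subseq_trans (prefix_subseq _ _); apply: subseq_trans (suffix_subseq _ _).
    rewrite /= eqxx -cats1 (_ : [:: e; g0] = [:: e] ++ [:: g0]) //.
    by rewrite cat_subseq ?sub1seq ?mem_head.
  have [lt0e|lte0|/inj_rho e0] := ltngtP (rho g0) (rho e); last by rewrite e0 eqxx in g0e.
    apply: (no g0 e z) => //; rewrite catA def_ut' def_w'.
    rewrite (_ : [:: g0; e; z] = [:: g0] ++ [:: e] ++ [:: z]) //.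
    apply: cat_subseq; first by rewrite sub1seq mem_cat inE mem_rcons mem_head !orbT.
    apply: subseq_trans (prefix_subseq _ _).
    by rewrite -cats1 cat_subseq ?sub1seq ?mem_head.
  apply: (no e g0 z) => //; rewrite catA def_ut' (_ : [:: e; g0; z] = [:: e; g0] ++ [:: z]) //.
  rewrite cat_subseq ?sub1seq //; apply: subseq_trans (suffix_subseq _ _).
  apply: subseq_trans (subseq_cons _ _).
  by rewrite -cats1 (_ : [:: e; g0] = [:: e] ++ [:: g0]) // cat_subseq ?sub1seq ?mem_head.
Qed.

(** The unfinished top [c] of [u] must leave before [z], so [x] is not [z], and [c = x] is the only
    unfinished colour of [g]. A colour of [u] strictly between [z] and [c] would be squeezed to the
    rank of [c]. *)
Lemma event_deep : (size p).+1 < size u -> sortable_from u (t ++ w) ->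
  size u = (size p).+2 /\ size (filter (mem w) g) <= 1.
Proof.
move=> deep [rho inj_rho [d av]].
have [g1 [c [def_u def_g]]] := deep_split deep.
have [//|x xw min_x] := @exists_rank_min rho w.
have zw : z \in w by rewrite mem_head.
have cw : c \in w by apply: (top_alive (u1 := p ++ z :: g1)); rewrite def_u rcons_cat.
have cg : c \in g by rewrite def_g mem_cat mem_rcons mem_head.
have le_c y : y \in z :: g1 -> rho c <= rho y.
  move=> yg; apply: d; rewrite def_u; apply: subseq_trans (suffix_subseq _ _).
  rewrite -rcons_cons -cats1 (_ : [:: y; c] = [:: y] ++ [:: c]) //.
  by rewrite cat_subseq ?sub1seq ?mem_head.
have cz : c != z by have /andP[] := g_notin cg.
have nxz : x != z.
  apply: contraNneq cz => xz; apply/eqP/inj_rho/eqP.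
  by rewrite eqn_leq le_c ?mem_head //= -xz min_x.
have le_x y : y \in g -> rho y <= rho x.
  exact: (rank_above_le inj_rho av def_ut uniq_ut xw min_x).
have alive_x y : y \in g -> y \in w -> y = x.
  by move=> yg yw; apply: (inj_rho); apply/eqP; rewrite eqn_leq le_x // min_x.
have cx := alive_x c cg cw.
have ug : uniq g by move: uniq_pzg; rewrite cat_uniq /= => /and4P[].
split.
  case: (g1) def_g def_u le_c => [_ ->|y g1' def_g _ le_c]; first by rewrite size_cat /= addn2.
  have yg : y \in g by rewrite def_g mem_head.
  have yc : y = c.
    apply: (inj_rho); apply/eqP; rewrite eqn_leq le_c ?inE ?eqxx ?orbT // andbT.
    by rewrite cx le_x.
  move: ug; rewrite def_g yc rcons_cons /= mem_cat mem_rcons mem_head.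
  by [].
have : all (pred1 x) (filter (mem w) g).
  by apply/allP => y; rewrite mem_filter => /andP[/= yw yg]; rewrite (alive_x y).
have := filter_uniq (mem w) ug; case: (filter _ g) => [//|a [//|b l]].
by rewrite /= inE => /and3P[/norP[ab _] _ _] /and3P[/eqP ax /eqP bx _]; rewrite ax bx eqxx in ab.
Qed.

End Event.

(** * The program *)

Local Notation r n := (Reg n).
Local Coercion Cst : nat >-> operand.

Local Notation l_index := 2 (only parsing).
Local Notation l_start := 8 (only parsing).
Local Notation l_main := 11 (only parsing).
Local Notation l_seen := 21 (only parsing).
Local Notation l_scan := 26 (only parsing).
Local Notation l_found := 38 (only parsing).
Local Notation l_look := 51 (only parsing).
Local Notation l_deep := 56 (only parsing).
Local Notation l_above := 57 (only parsing).
Local Notation l_below := 60 (only parsing).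
Local Notation l_last := 62 (only parsing).
Local Notation l_pop := 66 (only parsing).
Local Notation l_commit := 69 (only parsing).
Local Notation l_compact := 73 (only parsing).
Local Notation l_filter := 77 (only parsing).
Local Notation l_copy := 81 (only parsing).
Local Notation l_next := 83 (only parsing).
Local Notation l_compacted := 85 (only parsing).
Local Notation l_strict := 86 (only parsing).
Local Notation l_new := 94 (only parsing).
Local Notation l_top := 101 (only parsing).
Local Notation l_clean := 104 (only parsing).
Local Notation l_cleaned := 110 (only parsing).
Local Notation l_discard := 112 (only parsing).
Local Notation l_true := 114 (only parsing).
Local Notation l_false := 115 (only parsing).

(* With [N] the length of the input, cells [N + c] hold the position of the last
   sock of colour [c], cells [2N + c] tell whether [c] has been met, and the stack
   starts at cell [3N].  Registers: 1 is the number of socks read, 2 the end of the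
   stack, 3 the end of its committed part, 4 the current colour, 5 and 6 the bases
   [2N] and [3N]; 13 is the colour that leaves (or the dummy [N]), 14 the position
   up to which it leaves, 15 the address above which finished colours are kept. *)
Definition foot_program : program :=
  [:: Op Add 5 (r 0) (r 0); Op Add 6 (r 5) (r 0);
  (* l_index *)
      JmpEq (r 1) (r 0) l_start; Read 4 (r 1); Op Add 11 (r 0) (r 4);
      Write (r 11) (r 1); Op Add 1 (r 1) 1; JmpEq 0 0 l_index;
  (* l_start *)
      Op Add 1 0 0; Op Add 2 (r 6) 0; Op Add 3 (r 6) 0;
  (* l_main *)
      JmpEq (r 1) (r 0) l_true; Read 4 (r 1); Op Add 11 (r 5) (r 4);
      Read 12 (r 11); JmpEq (r 12) 1 l_seen; Write (r 11) 1; Write (r 2) (r 4);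
      Op Add 2 (r 2) 1; Op Add 1 (r 1) 1; JmpEq 0 0 l_main;
  (* l_seen *)
      Op Defs.Sub 11 (r 2) 1; Read 12 (r 11); JmpEq (r 12) (r 4) l_top;
      Op Add 7 (r 2) 0; Op Add 8 0 0;
  (* l_scan *)
      Op Add 11 (r 7) 1; JmpLt (r 11) (r 3) l_false; Op Defs.Sub 7 (r 7) 1;
      Read 12 (r 7); JmpEq (r 12) (r 4) l_found; Op Add 11 (r 0) (r 12);
      Read 11 (r 11); JmpLt (r 11) (r 1) l_scan; Op Add 8 (r 8) 1;
      Op Add 9 (r 12) 0; Op Add 10 (r 7) 0; JmpEq 0 0 l_scan;
  (* l_found *)
      Op Add 11 (r 7) 1; JmpLt (r 11) (r 3) l_deep; JmpEq (r 8) 0 l_pop;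
      JmpLt 1 (r 8) l_below; Op Add 11 (r 0) (r 9); Read 11 (r 11);
      Op Add 12 (r 0) (r 4); Read 12 (r 12); JmpLt (r 11) (r 12) l_above;
      Op Defs.Sub 11 (r 2) 1; Read 11 (r 11); JmpEq (r 11) (r 9) l_below;
      Op Add 7 (r 1) 0;
  (* l_look *)
      JmpEq (r 7) (r 12) l_below; Read 11 (r 7); JmpEq (r 11) (r 9) l_above;
      Op Add 7 (r 7) 1; JmpEq 0 0 l_look;
  (* l_deep *)
      JmpLt 1 (r 8) l_false;
  (* l_above *)
      Op Add 13 (r 9) 0; Op Add 15 (r 2) 0; JmpEq 0 0 l_last;
  (* l_below *)
      Op Add 13 (r 4) 0; Op Add 15 (r 10) 0;
  (* l_last *)
      Op Add 14 (r 0) (r 13); Read 14 (r 14); Op Add 14 (r 14) 1;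
      JmpEq 0 0 l_commit;
  (* l_pop *)
      Op Add 13 (r 0) 0; Op Add 14 (r 1) 0; Op Add 15 (r 2) 0;
  (* l_commit *)
      Op Defs.Sub 16 (r 3) (r 6); Op Defs.Sub 16 (r 16) 1; Op Add 16 (r 16) (r 6);
      Op Add 7 (r 16) 0;
  (* l_compact *)
      JmpEq (r 7) (r 2) l_compacted; Read 4 (r 7); JmpLt (r 7) (r 15) l_filter;
      JmpEq 0 0 l_copy;
  (* l_filter *)
      JmpEq (r 4) (r 13) l_next; Op Add 11 (r 0) (r 4); Read 11 (r 11);
      JmpLt (r 11) (r 1) l_next;
  (* l_copy *)
      Write (r 16) (r 4); Op Add 16 (r 16) 1;
  (* l_next *)
      Op Add 7 (r 7) 1; JmpEq 0 0 l_compact;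
  (* l_compacted *)
      Op Add 2 (r 16) 0;
  (* l_strict *)
      JmpEq (r 1) (r 14) l_clean; Read 4 (r 1); Op Add 1 (r 1) 1;
      JmpEq (r 4) (r 13) l_strict; JmpEq (r 2) (r 6) l_new; Op Defs.Sub 11 (r 2) 1;
      Read 11 (r 11); JmpEq (r 11) (r 4) l_strict;
  (* l_new *)
      Op Add 11 (r 5) (r 4); Read 12 (r 11); JmpEq (r 12) 1 l_false; Write (r 11) 1;
      Write (r 2) (r 4); Op Add 2 (r 2) 1; JmpEq 0 0 l_strict;
  (* l_top *)
      Op Add 1 (r 1) 1; JmpEq (r 2) (r 3) l_clean; JmpEq 0 0 l_main;
  (* l_clean *)
      JmpEq (r 2) (r 6) l_cleaned; Op Defs.Sub 11 (r 2) 1; Read 11 (r 11);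
      Op Add 11 (r 0) (r 11); Read 11 (r 11); JmpLt (r 11) (r 1) l_discard;
  (* l_cleaned *)
      Op Add 3 (r 2) 0; JmpEq 0 0 l_main;
  (* l_discard *)
      Op Defs.Sub 2 (r 2) 1; JmpEq 0 0 l_clean;
  (* l_true *)
      Halt true;
  (* l_false *)
      Halt false].

Arguments upd f a v b /.

(** * Symbolic execution with a time bound *)

(** Termination, time bound and correct answer are bundled so that one forward execution proves all
    three; [n] is the fuel left. *)
Definition solves W P n st (Q : Prop) :=
  exists t b, [/\ halts_in W P st t b, t <= n & b <-> Q].

Section Solves.
Variables (W : nat) (P : program).

Lemma solves_weaken m n st Q : m <= n -> solves W P m st Q -> solves W P n st Q.
Proof. by move=> mn [t [b [h tm bQ]]]; exists t, b; rewrite (leq_trans tm). Qed.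

Lemma solves_iff n st Q Q' : (Q <-> Q') -> solves W P n st Q' -> solves W P n st Q.
Proof. by move=> QQ' [t [b [h tm bQ]]]; exists t, b; split=> //; rewrite bQ QQ'. Qed.

Lemma solves_exec n l rg m i st Q : onth P l = Some i ->
  exec W i (State l rg m) = Some st -> solves W P n st Q ->
  solves W P n.+1 (State l rg m) Q.
Proof.
move=> Pi ei [t [b [h tn bQ]]]; exists t.+1, b; split=> //.
exact: (@HaltsStep W P (State l rg m) _ _ _ _ Pi ei h).
Qed.

Lemma solves_op op d a b n l rg m Q : onth P l = Some (Op op d a b) ->
  let v := arith_val op (operand_val (State l rg m) a) (operand_val (State l rg m) b) in
  v < W -> solves W P n (State l.+1 (upd rg d v) m) Q ->
  solves W P n.+1 (State l rg m) Q.
Proof. by move=> Pi v vW; apply: solves_exec Pi _; rewrite /= -/v vW. Qed.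

Lemma solves_read d a v n l rg m Q : onth P l = Some (Read d a) ->
  let k := operand_val (State l rg m) a in
  k < W -> m k = v -> v < W -> solves W P n (State l.+1 (upd rg d v) m) Q ->
  solves W P n.+1 (State l rg m) Q.
Proof. by move=> Pi k kW mk vW; apply: solves_exec Pi _; rewrite /= -/k mk kW vW. Qed.

Lemma solves_write a b n l rg m Q : onth P l = Some (Write a b) ->
  let k := operand_val (State l rg m) a in
  let v := operand_val (State l rg m) b in
  k < W -> v < W -> solves W P n (State l.+1 rg (upd m k v)) Q ->
  solves W P n.+1 (State l rg m) Q.
Proof. by move=> Pi k v kW vW; apply: solves_exec Pi _; rewrite /= -/k -/v kW vW. Qed.

Lemma solves_goto a l' n l rg m Q : onth P l = Some (JmpEq a a l') ->
  solves W P n (State l' rg m) Q -> solves W P n.+1 (State l rg m) Q.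
Proof. by move=> Pi; apply: solves_exec Pi _; rewrite /= eqxx. Qed.

Lemma solves_eq a b l' n l rg m Q : onth P l = Some (JmpEq a b l') ->
  let x := operand_val (State l rg m) a in
  let y := operand_val (State l rg m) b in
  (x = y -> solves W P n (State l' rg m) Q) ->
  (x <> y -> solves W P n (State l.+1 rg m) Q) -> solves W P n.+1 (State l rg m) Q.
Proof.
move=> Pi x y h h'; have [e|nxy] := eqVneq x y.
  by apply: solves_exec Pi _ (h e); rewrite /= -/x -/y e eqxx.
by apply: solves_exec Pi _ (h' (elimN eqP nxy)); rewrite /= -/x -/y (negbTE nxy).
Qed.

Lemma solves_lt a b l' n l rg m Q : onth P l = Some (JmpLt a b l') ->
  let x := operand_val (State l rg m) a in
  let y := operand_val (State l rg m) b in
  (x < y -> solves W P n (State l' rg m) Q) ->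
  (y <= x -> solves W P n (State l.+1 rg m) Q) -> solves W P n.+1 (State l rg m) Q.
Proof.
move=> Pi x y h h'; have [lt|le] := ltnP x y.
  by apply: solves_exec Pi _ (h lt); rewrite /= -/x -/y lt.
by apply: solves_exec Pi _ (h' le); rewrite /= -/x -/y ltnNge le.
Qed.

Lemma solves_halt b n l rg m (Q : Prop) : onth P l = Some (Halt b) -> (b <-> Q) ->
  solves W P n.+1 (State l rg m) Q.
Proof. by move=> Pi bQ; exists 1, b; split=> //; apply: HaltsNow. Qed.

End Solves.

Ltac goto := eapply solves_goto; [reflexivity | simpl].
Ltac op := eapply solves_op; [reflexivity | simpl; lia | simpl].
Ltac read v := eapply (solves_read (v := v)); [reflexivity | simpl; lia | simpl | lia | simpl].
Ltac write := eapply solves_write; [reflexivity | simpl; lia | simpl; lia | simpl].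
Ltac branch_eq := eapply solves_eq; [reflexivity | simpl | simpl].
Ltac branch_lt := eapply solves_lt; [reflexivity | simpl | simpl].

(** * Last occurrences *)

(** For an absent colour the truncated subtraction gives 0, the initial content of its table cell,
    so the indexing loop needs no separate case. *)
Definition last_pos (s : seq nat) c := size s - (index c (rev s)).+1.

Lemma last_pos_rcons l x c :
  last_pos (rcons l x) c = if x == c then size l else last_pos l c.
Proof. by rewrite /last_pos rev_rcons size_rcons /=; case: eqP; rewrite subSS ?subn0. Qed.

(** This turns the question whether a colour is unfinished into one comparison with a table
    entry. *)
Lemma leq_last_pos s c i : c \in s -> (i <= last_pos s c) = (c \in drop i s).
Proof.
elim/last_ind: s => [//|l x IH]; rewrite mem_rcons inE last_pos_rcons eq_sym.
have [il|li] := leqP i (size l).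
  rewrite drop_rcons // mem_rcons inE (eq_sym c x).
  by case: eqP => //= _ /IH.
rewrite drop_oversize ?size_rcons // in_nil.
case: eqP => /= [_ _|_ /IH->]; first by rewrite leqNgt li.
by rewrite drop_oversize // ltnW.
Qed.

Lemma last_pos_lt s c : c \in s -> last_pos s c < size s.
Proof. by move=> cs; rewrite ltnNge leq_last_pos // drop_size. Qed.

Lemma nth_last_pos s c : c \in s -> nth 0 s (last_pos s c) = c.
Proof.
move=> cs; have := leq_last_pos (last_pos s c) cs; have := leq_last_pos (last_pos s c).+1 cs.
rewrite ltnn leqnn (drop_nth 0 (last_pos_lt cs)) inE => <-; rewrite orbF.
by move/esym/eqP.
Qed.

Lemma take_last_pos s c i : i <= last_pos s c -> c \in s ->
  take ((last_pos s c).+1 - i) (drop i s) = rcons (take (last_pos s c - i) (drop i s)) c.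
Proof.
move=> il cs; rewrite subSn // (take_nth 0).
  by rewrite nth_drop subnKC // nth_last_pos.
by rewrite size_drop ltn_sub2r ?(leq_ltn_trans il) ?last_pos_lt.
Qed.

Lemma drop_last_pos s c : c \in s -> c \notin drop (last_pos s c).+1 s.
Proof. by move=> cs; rewrite -leq_last_pos // ltnn. Qed.

(** * Correctness of the program *)

Section Correctness.

Variables (s : seq nat) (N W : nat).
Hypotheses (size_s : size s = N) (s_lt : {in s, forall c, c < N}) (def_W : W = 4 * N + 2).

Local Notation exe := (solves W foot_program).

Definition base_regs (rg : nat -> nat) := [/\ rg 0 = N, rg 5 = 2 * N & rg 6 = 3 * N].

Definition mem_tables (i : nat) (m : nat -> nat) :=
  [/\ {in gtn N, forall j, m j = nth 0 s j},
      {in s, forall c, m (N + c) = last_pos s c}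
    & {in gtn N, forall c, m (2 * N + c) = (c \in take i s)}].

Definition mem_stack (A : seq nat) (m : nat -> nat) :=
  {in gtn (size A), forall j, m (3 * N + j) = nth 0 A j}.

Lemma stack_size (A : seq nat) : uniq A -> {subset A <= s} -> size A <= N.
Proof.
move=> uA As; rewrite -(size_iota 0 N); apply: uniq_leq_size => // c /As cs.
by rewrite mem_iota add0n s_lt.
Qed.

Lemma last_pos_ltN c : c \in s -> last_pos s c < N.
Proof. by move/last_pos_lt; rewrite size_s. Qed.

(** * The loops of the program *)

(** Like the other loops, this one is specified by continuation: it suffices to solve every state in
    which it may exit. An iteration takes 8 instructions, paid by the discarded colour, so the share
    of the surviving [A'] is passed on. *)
Lemma clean_ok Q i n A rg m :
  base_regs rg -> rg 1 = i -> rg 2 = 3 * N + size A -> mem_tables i m ->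
  mem_stack A m -> uniq A -> {subset A <= s} ->
  (forall A' g rg', A = A' ++ g -> {in g, forall c, c \notin drop i s} ->
    (forall A1 c, A' = rcons A1 c -> c \in drop i s) ->
    base_regs rg' -> rg' 1 = i -> rg' 2 = 3 * N + size A' -> rg' 3 = 3 * N + size A' ->
    exe (8 * size A' + n) (State l_main rg' m) Q) ->
  exe (8 * size A + n).+4.+4 (State l_clean rg m) Q.
Proof.
elim/last_ind: A rg => [|A c IH] rg [r0 r5 r6] r1 r2 [ms ml mseen] mA uA As hQ.
  rewrite /= addn0 in r2; branch_eq; last by rewrite r2 r6.
  move=> _; op; goto; apply: (solves_weaken (m := n)); first by lia.
  apply: (hQ [::] [::]) => //=; try lia.
  by case.
have sA := stack_size uA As; rewrite size_rcons in r2 sA.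
have cs : c \in s by apply: As; rewrite mem_rcons mem_head.
have cN := s_lt cs; have lc := last_pos_ltN cs.
rewrite size_rcons mulnS -addnA.
branch_eq; first by lia.
move=> _; op; read c.
  have -> : rg 2 - 1 = 3 * N + size A by lia.
  by rewrite mA ?inE ?size_rcons // nth_rcons ltnn eqxx.
op; read (last_pos s c); first by rewrite r0 ml.
branch_lt => [lt|le].
  op; goto; apply: IH => //=; [lia|..].
  - by move=> j; rewrite inE => jA; rewrite mA ?inE ?size_rcons ?leqW // nth_rcons jA.
  - by move: uA; rewrite rcons_uniq => /andP[].
  - by move=> y yA; apply: As; rewrite mem_rcons inE yA orbT.
  move=> A' g rg' def_A gdead; apply: (hQ _ (rcons g c)); first by rewrite def_A rcons_cat.
  move=> y; rewrite mem_rcons inE => /orP[/eqP->|/gdead//].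
  by rewrite -leq_last_pos // -ltnNge -r1.
op; goto; apply: (solves_weaken (m := 8 * size (rcons A c) + n)); first by rewrite size_rcons; lia.
apply: (hQ _ [::]) => //=; rewrite ?cats0 ?size_rcons //; try lia.
by move=> A1 c1 /rcons_inj[_ <-]; rewrite -leq_last_pos // -r1.
Qed.

Lemma take_succ (i : nat) : i < N -> take i.+1 s = rcons (take i s) (nth 0 s i).
Proof. by move=> iN; rewrite (take_nth 0) ?size_s. Qed.

Lemma drop_pred (i : nat) : i < N -> drop i s = nth 0 s i :: drop i.+1 s.
Proof. by move=> iN; rewrite (drop_nth 0) ?size_s. Qed.

Lemma nth_lt i : i < N -> nth 0 s i < N.
Proof. by move=> iN; apply: s_lt; rewrite mem_nth ?size_s. Qed.

Lemma mem_tables_new i m : i < N -> mem_tables i m ->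
  mem_tables i.+1 (upd m (2 * N + nth 0 s i) 1).
Proof.
move=> iN [ms ml mseen]; have yN := nth_lt iN; split.
- by move=> j; rewrite inE => jN /=; case: eqP => [|_]; [lia | rewrite ms ?inE].
- by move=> c cs /=; have := s_lt cs; case: eqP => [|_ _]; [lia | rewrite ml].
- move=> c; rewrite inE => cN /=; rewrite take_succ // mem_rcons inE.
  by rewrite eqn_add2l; case: eqP => //= _; rewrite mseen ?inE.
Qed.

Lemma mem_tables_old i m : i < N -> nth 0 s i \in take i s -> mem_tables i m ->
  mem_tables i.+1 m.
Proof.
move=> iN yi [ms ml mseen]; split=> // c cN; rewrite mseen // take_succ //.
by rewrite mem_rcons inE; case: eqP => [->|//]; rewrite yi.
Qed.

Lemma mem_tables_stack i m k v : 3 * N <= k -> mem_tables i m -> mem_tables i (upd m k v).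
Proof.
move=> kN [ms ml mseen]; split.
- by move=> j; rewrite inE => jN /=; case: eqP => [|_]; [lia | rewrite ms ?inE].
- by move=> c cs /=; have := s_lt cs; case: eqP => [|_ _]; [lia | rewrite ml].
- by move=> c; rewrite inE => cN /=; case: eqP => [|_]; [lia | rewrite mseen ?inE].
Qed.

Lemma mem_stack_push A m k v y : k < 3 * N -> mem_stack A m ->
  mem_stack (rcons A y) (upd (upd m k v) (3 * N + size A) y).
Proof.
move=> kN mA j; rewrite inE size_rcons ltnS => jA /=; rewrite eqn_add2l nth_rcons.
have [->|/eqP jA'] := eqVneq j (size A); first by rewrite ltnn.
have ltj : j < size A by lia.
by rewrite ltj; case: (eqVneq (3 * N + j) k) => [|_]; [lia | rewrite mA ?inE].
Qed.

(** The whole stack is committed while [x] leaves. By [alive], a colour other than [x] that was met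
    before and comes again is still stacked, so unless it is on top, its mark in the table suffices
    to reject. *)
Lemma strict_ok i A n E x rg m :
  base_regs rg -> rg 1 = i -> rg 2 = 3 * N + size A -> rg 13 = x -> rg 14 = E ->
  mem_tables i m -> mem_stack A m -> i <= E <= N -> (i < E -> x \in take i s) ->
  uniq A -> {subset A <= take i s} ->
  {in take i s, forall c, c \in drop i s -> c = x \/ c \in A} ->
  (forall A' rg' m', base_regs rg' -> rg' 1 = E -> rg' 2 = 3 * N + size A' ->
    mem_tables E m' -> mem_stack A' m' -> uniq A' -> {subset A' <= take E s} ->
    {in take E s, forall c, c \in drop E s -> c = x \/ c \in A'} ->
    size A' <= size A + (E - i) ->
    exe n (State l_clean rg' m') (sortable_from A' (drop E s))) ->
  exe (15 * (E - i) + n).+1 (State l_strict rg m)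
    (sortable_from (A ++ filter (predC1 x) (take (E - i) (drop i s))) (drop E s)).
Proof.
have [k] := ubnP (E - i); elim: k => // k IH in i A rg m *; rewrite ltnS => ltk.
move=> [r0 r5 r6] r1 r2 r13 r14 mt mA /andP[iE EN] xi uA As alive hQ.
have [ms ml mseen] := mt; have As' : {subset A <= s} by move=> y /As /mem_take.
have sA := stack_size uA As'.
branch_eq; rewrite r1 r14.
  move=> eE; rewrite eE subnn take0 cats0 muln0 in hQ *.
  by apply: hQ; rewrite -?eE // leq_addr.
move=> /eqP neE; have ltiE : i < E by rewrite ltn_neqAle neE.
have iN := leq_trans ltiE EN; set y := nth 0 s i.
have yN : y < N by apply: nth_lt.
have subE : E - i = (E - i.+1).+1 by lia.
have yd : y \in drop i s by rewrite drop_pred // mem_head.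
have xi1 : i.+1 < E -> x \in take i.+1 s.
  by rewrite take_succ // mem_rcons inE xi ?orbT.
have dropi c : c \in drop i.+1 s -> c \in drop i s.
  by rewrite (drop_pred iN) inE => ->; rewrite orbT.
rewrite subE mulnS -addnA drop_pred // [take _ (_ :: _)]/= -/y.
read y; first by rewrite r1 ms.
op; branch_eq; rewrite r13; [move=> yx | move=> /eqP yx].
  rewrite /= yx eqxx /=; apply: (solves_weaken (m := (15 * (E - i.+1) + n).+1)); first by lia.
  apply: IH => //=; try lia.
  - by apply: mem_tables_old => //; rewrite -/y yx xi.
  - by move=> c /As; rewrite take_succ // mem_rcons inE => ->; rewrite orbT.
  - move=> c; rewrite take_succ // mem_rcons inE -/y yx => /orP[/eqP->|ci cd]; first by left.
    by apply: alive => //; apply: dropi.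
  - move=> A' rg' m' *; apply: hQ => //; lia.
rewrite /= yx.
set rest := [seq _ <- _ | _].
have old_ok rg' : base_regs rg' -> rg' 1 = i.+1 -> rg' 2 = 3 * N + size A ->
  rg' 13 = x -> rg' 14 = E -> y \in A ->
  exe (15 * (E - i.+1) + n).+1 (State l_strict rg' m) (sortable_from (A ++ rest) (drop E s)).
  move=> ? ? ? ? ? yA; have yi := As _ yA.
  apply: IH => //=; try lia.
  - exact: mem_tables_old.
  - by move=> c /As; rewrite take_succ // mem_rcons inE => ->; rewrite orbT.
  - move=> c; rewrite take_succ // mem_rcons inE -/y => /orP[/eqP-> _|ci cd]; first by right.
    by apply: alive => //; apply: dropi.
  - by move=> A' rg'' m' *; apply: hQ => //; lia.
have new_ok rg' : (forall A1, A <> rcons A1 y) -> base_regs rg' -> rg' 1 = i.+1 ->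
  rg' 2 = 3 * N + size A -> rg' 4 = y -> rg' 13 = x -> rg' 14 = E ->
  exe (8 + (15 * (E - i.+1) + n)) (State l_new rg' m)
    (sortable_from (A ++ y :: rest) (drop E s)).
  move=> ntop [r0' r5' r6'] r1' r2' r4' r13' r14'.
  op; read (y \in take i s : nat); first by rewrite r5' r4' mseen ?inE.
  branch_eq.
    case: (boolP (y \in take i s)) => // yi _.
    have yA : y \in A by case: (alive y yi yd) yx => [->|//]; rewrite eqxx.
    eapply solves_halt; first by reflexivity.
    split=> // -[rho inj_rho [d _]]; exfalso.
    (* Here [y] lies below another colour [c] and comes again above it: [dec] bounds their ranks
       both ways, against injectivity. *)
    case: (lastP A) yA ntop d => [//|A1 c]; rewrite mem_rcons inE.
    move=> yA1 ntop; have cy : c != y by apply/eqP => cy; apply: (ntop A1); rewrite cy.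
    rewrite eq_sym (negbTE cy) /= in yA1; move=> d; move/eqP: cy; apply; apply: (inj_rho).
    apply/eqP; rewrite eqn_leq; apply/andP; split; apply: d.
      apply: subseq_trans (prefix_subseq _ _); rewrite -cats1 -[[:: y; c]]cat1s.
      by rewrite cat_subseq ?sub1seq ?mem_head.
    by rewrite -[[:: c; y]]cat1s cat_subseq ?sub1seq ?mem_head // mem_rcons mem_head.
  case: (boolP (y \in take i s)) => // yi _.
  write; write; op; goto; rewrite r5' r4' r2' -cat_rcons.
  apply: (solves_weaken (m := (15 * (E - i.+1) + n).+1)); first by lia.
  apply: IH => //=; try lia.
  - by rewrite size_rcons addn1 addnS.
  - by apply: mem_tables_stack; [lia | apply: mem_tables_new].
  - by apply: mem_stack_push => //; lia.
  - by rewrite rcons_uniq uA andbT; apply: contra yi => /As.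
  - move=> c; rewrite take_succ // !mem_rcons !inE -/y => /orP[->//|/As->].
    by rewrite orbT.
  - move=> c; rewrite take_succ // !mem_rcons !inE -/y => /orP[/eqP->|ci cd].
      by right; rewrite eqxx.
    by case: (alive c ci (dropi _ cd)) => [->|->]; [left | right; rewrite orbT].
  - by move=> A' rg'' m'; rewrite size_rcons => *; apply: hQ => //; lia.
branch_eq; first (move=> eq26; apply: (solves_weaken (m := 8 + (15 * (E - i.+1) + n)))).
- by lia.
- apply: new_ok; rewrite //= ?r1 ?addn1 //.
  by move=> A1 def_A; move: r2; rewrite def_A size_rcons; lia.
move=> ne26; case/lastP: A => [|A1 c] in r2 mA uA As alive hQ As' sA old_ok new_ok *.
  by move: r2 => /=; lia.
have cN : c < N by apply/s_lt/As'; rewrite mem_rcons mem_head.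
rewrite size_rcons in r2 sA.
op; read c.
  have -> : rg 2 - 1 = 3 * N + size A1 by lia.
  by rewrite mA ?inE ?size_rcons // nth_rcons ltnn eqxx.
branch_eq => [cy|/eqP cy].
  apply: (solves_weaken (m := (15 * (E - i.+1) + n).+1)); first by lia.
  rewrite -cy; apply: solves_iff (sortable_from_stutter _ _ _ _) _.
  by apply: old_ok; rewrite //= ?r1 ?addn1 ?size_rcons // ?mem_rcons -?cy ?mem_head.
apply: (solves_weaken (m := 8 + (15 * (E - i.+1) + n))); first by lia.
apply: new_ok; rewrite //= ?r1 ?addn1 ?size_rcons //.
by move=> A2 /rcons_inj[_ /eqP]; rewrite (negbTE cy).
Qed.

(** Compaction is done in place: the write address [3 * N + size B] never passes the read address
    [q], so the unread part [L] survives every write. *)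
Lemma compact_ok Q i n (B L : seq nat) q E x lim rg m :
  base_regs rg -> rg 1 = i -> rg 7 = q -> rg 2 = q + size L ->
  rg 16 = 3 * N + size B -> rg 13 = x -> rg 14 = E -> rg 15 = lim ->
  3 * N + size B <= q -> q + size L <= 4 * N ->
  mem_tables i m -> mem_stack B m -> {subset L <= s} ->
  {in gtn (size L), forall j, m (q + j) = nth 0 L j} ->
  (forall rg' m', let C := B ++ filter (fun c => (c \in drop i s) && (c != x)) (take (lim - q) L)
                             ++ drop (lim - q) L in
    base_regs rg' -> rg' 1 = i -> rg' 2 = 3 * N + size C -> rg' 13 = x -> rg' 14 = E ->
    mem_tables i m' -> mem_stack C m' -> exe n (State l_strict rg' m') Q) ->
  exe (12 * size L + n).+2 (State l_compact rg m) Q.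
Proof.
elim: L B q rg m => [|c L IH] B q rg m [r0 r5 r6] r1 r7 r2 r16 r13 r14 r15 Bq q4 mt mB Ls mL hQ.
  rewrite /= addn0 in r2 q4; branch_eq; last by rewrite r7 r2.
  by move=> _; op; apply: hQ; rewrite //= ?cats0 ?addn0.
have [ms ml mseen] := mt; rewrite /= in r2 q4.
have cs : c \in s by apply: Ls; rewrite mem_head.
have cN := s_lt cs; have lc := last_pos_ltN cs.
have Ls' : {subset L <= s} by move=> y yL; apply: Ls; rewrite inE yL orbT.
have m_cons m' : (forall k, q < k -> m' k = m k) ->
    {in gtn (size L), forall j, m' (q.+1 + j) = nth 0 L j}.
  move=> hm' j; rewrite inE => jL; rewrite hm'; last by lia.
  by rewrite addSnnS mL ?inE.
rewrite [size (_ :: _)]/= mulnS -addnA.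
have keep_ok rg' : base_regs rg' -> rg' 1 = i -> rg' 7 = q -> rg' 2 = q + (size L).+1 ->
    rg' 16 = 3 * N + size B -> rg' 13 = x -> rg' 14 = E -> rg' 15 = lim -> rg' 4 = c ->
    (q < lim -> (c \in drop i s) && (c != x)) ->
    exe (12 * size L + n).+2.+4 (State l_copy rg' m) Q.
  move=> [r0' r5' r6'] r1' r7' r2' r16' r13' r14' r15' r4' hkeep.
  write; op; op; goto; rewrite r16' r4'.
  apply: (IH (rcons B c) q.+1); rewrite //= ?size_rcons; try lia.
  - exact: mem_tables_stack (leq_addr _ _) mt.
  - move=> j; rewrite inE size_rcons ltnS => jB /=; rewrite eqn_add2l nth_rcons.
    have [->|jB'] := eqVneq j (size B); first by rewrite ltnn.
    by have ltj : j < size B by [lia]; rewrite ltj mB ?inE.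
  - by apply: (m_cons (upd m (3 * N + size B) c)) => k qk /=; case: eqP => // ek; lia.
  - have eC : B ++ [seq c0 <- take (lim - q) (c :: L) | (c0 \in drop i s) && (c0 != x)]
        ++ drop (lim - q) (c :: L) = rcons B c ++
        [seq c0 <- take (lim - q.+1) L | (c0 \in drop i s) && (c0 != x)] ++ drop (lim - q.+1) L.
      rewrite cat_rcons; have [lt|le] := ltnP q lim.
        by rewrite -(subnSK lt) /= hkeep.
      by have [-> ->] : lim - q = 0 /\ lim - q.+1 = 0 by [lia]; rewrite !take0 !drop0.
    by move=> rg'' m' *; apply: hQ => //; rewrite eC.
have skip_ok rg' : base_regs rg' -> rg' 1 = i -> rg' 7 = q -> rg' 2 = q + (size L).+1 ->
    rg' 16 = 3 * N + size B -> rg' 13 = x -> rg' 14 = E -> rg' 15 = lim -> rg' 4 = c ->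
    q < lim -> (c \in drop i s) && (c != x) = false ->
    exe (12 * size L + n).+2.+2 (State l_next rg' m) Q.
  move=> [r0' r5' r6'] r1' r7' r2' r16' r13' r14' r15' r4' lt skip.
  op; goto; apply: (IH B q.+1); rewrite //=; try lia.
    by apply: m_cons.
  have eC : B ++ [seq c0 <- take (lim - q) (c :: L) | (c0 \in drop i s) && (c0 != x)]
      ++ drop (lim - q) (c :: L) =
      B ++ [seq c0 <- take (lim - q.+1) L | (c0 \in drop i s) && (c0 != x)]
      ++ drop (lim - q.+1) L by rewrite -(subnSK lt) /= skip.
  by move=> rg'' m' *; apply: hQ => //; rewrite eC.
branch_eq; first by lia.
move=> _; read c; first by rewrite r7 -[q]addn0 mL.
branch_lt; rewrite r7 r15; last first.
  move=> le; goto; apply: (solves_weaken (m := (12 * size L + n).+2.+4)); first by lia.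
  by apply: keep_ok => //=; lia.
move=> lt; branch_eq; rewrite r13.
  move=> cx; apply: (solves_weaken (m := (12 * size L + n).+2.+2)); first by lia.
  by apply: skip_ok => //=; rewrite cx eqxx andbF.
move=> /eqP cx; op; read (last_pos s c); first by rewrite r0 ml.
branch_lt; rewrite r1.
  move=> li; apply: (solves_weaken (m := (12 * size L + n).+2.+2)); first by lia.
  by apply: skip_ok => //=; rewrite -leq_last_pos // leqNgt li.
move=> il; apply: (solves_weaken (m := (12 * size L + n).+2.+4)); first by lia.
by apply: keep_ok => //=; rewrite -leq_last_pos // il.
Qed.

Lemma look_ok Q n e j l rg m :
  rg 7 = j -> rg 12 = l -> rg 9 = e -> {in gtn N, forall k, m k = nth 0 s k} ->
  j <= l < N ->
  (forall rg', {in predC (mem [:: 7; 11]), rg' =1 rg} ->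
    exe n (State (if e \in take (l - j) (drop j s) then l_above else l_below) rg' m) Q) ->
  exe (5 * (l - j) + n).+1 (State l_look rg m) Q.
Proof.
move def_k: (l - j) => k; elim: k j def_k rg => [|k IH] j def_k rg r7 r12 r9 ms jl hQ.
  branch_eq; last by case; lia.
  by move=> _; rewrite take0 /= in hQ; apply: hQ.
have jN : j < N by lia.
rewrite mulnS -addnA; branch_eq; first by lia.
have yN := nth_lt jN.
move=> _; read (nth 0 s j); first by rewrite r7 ms.
rewrite drop_pred //= inE in hQ.
branch_eq; rewrite r9.
  move=> ej; apply: (solves_weaken (m := n)); first by lia.
  rewrite -ej eqxx /= in hQ; apply: hQ => a; rewrite !inE negb_or => /andP[_ /negbTE h].
  by rewrite /= h.
move=> /eqP; rewrite eq_sym => /negbTE ej; rewrite ej /= in hQ.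
op; goto; apply: (IH j.+1); rewrite //=; try lia.
move=> rg' h; apply: hQ => a ha; rewrite h //.
move: ha; rewrite !inE negb_or => /andP[/negbTE a7 /negbTE a11].
by rewrite /= a7 a11.
Qed.

(* Register 8 counts the unfinished colours above position [k] of the stack; the
   lowest of them is in register 9, and its address in register 10. *)
Definition scan_regs i k (g : seq nat) (rg : nat -> nat) :=
  exists gf ga : seq nat, [/\ g = gf ++ ga, {in gf, forall c, c \notin drop i s},
    rg 8 = size (filter (mem (drop i s)) ga)
    & ga != [::] -> [/\ head 0 ga \in drop i s, rg 9 = head 0 ga
                      & rg 10 = 3 * N + k + size gf]].

(** The scan gives up after passing two committed colours without meeting [z], a situation that
    [event_deep] excludes. Its cost is therefore governed by the uncommitted part alone. *)
Lemma scan_ok Q i n (A pre g : seq nat) cb z rg m :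
  A = pre ++ g -> base_regs rg -> rg 1 = i -> rg 2 = 3 * N + size A ->
  rg 3 = 3 * N + cb -> rg 4 = z -> rg 7 = 3 * N + size pre -> z \in pre ->
  scan_regs i (size pre) g rg -> size A <= N -> {subset A <= s} ->
  mem_tables i m -> mem_stack A m ->
  (forall (p g : seq nat) rg', A = p ++ z :: g -> (size p).+2 < cb ->
    exe n (State l_false rg' m) Q) ->
  (forall (p g : seq nat) rg', A = p ++ z :: g -> cb <= (size p).+2 -> base_regs rg' -> rg' 1 = i ->
    rg' 2 = 3 * N + size A -> rg' 3 = 3 * N + cb -> rg' 4 = z ->
    rg' 7 = 3 * N + size p -> scan_regs i (size p).+1 g rg' ->
    exe n (State l_found rg' m) Q) ->
  exe (12 * ((size pre).+2 - cb) + n).+3 (State l_scan rg m) Q.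
Proof.
elim/last_ind: pre g rg => [//|pre c IH] g rg def_A [r0 r5 r6] r1 r2 r3 r4 r7 zpre.
move=> hscan sA As [ms ml mseen] mA hfail hfound; rewrite size_rcons in r7 hscan *.
have sA' := sA; rewrite def_A size_cat size_rcons in sA'.
have cs : c \in s by apply: As; rewrite def_A mem_cat mem_rcons mem_head.
have cN := s_lt cs; have lc := last_pos_ltN cs.
(* From [size A <= N] this sum is at most [4 * N + 1], just below the word bound. *)
op; branch_lt.
  move=> lt; apply: (solves_weaken (m := n)); first by lia.
  have [p1 [p2 def_p]] : exists p1 p2 : seq nat, rcons pre c = p1 ++ z :: p2.
    by case/splitPr: zpre => p1 p2; exists p1, p2.
  apply: (hfail p1 (p2 ++ g)); first by rewrite def_A def_p -catA.
  by have := congr1 size def_p; rewrite size_rcons size_cat /=; lia.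
move=> le; have -> : (size pre).+3 - cb = ((size pre).+2 - cb).+1 by lia.
rewrite mulnS -addnA; op; have e7 : rg 7 - 1 = 3 * N + size pre by lia.
read c.
  rewrite e7 mA ?inE def_A ?size_cat ?size_rcons ?ltn_addr //.
  by rewrite nth_cat size_rcons ltnSn nth_rcons ltnn eqxx.
rewrite e7; branch_eq; rewrite r4.
  move=> cz; apply: (solves_weaken (m := n)); first by lia.
  by apply: (hfound pre g) => //=; [rewrite def_A cat_rcons cz | lia].
move=> /eqP cz; move: zpre; rewrite mem_rcons inE eq_sym (negbTE cz) /= => zpre.
have [gf [ga [def_g gfd r8 hga]]] := hscan.
have le8 : rg 8 <= N.
  rewrite r8; apply: leq_trans sA; rewrite def_A def_g !size_cat.
  by rewrite size_filter; apply: leq_trans (count_size _ _) _; rewrite addnA leq_addl.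
op; read (last_pos s c); first by rewrite r0 ml.
branch_lt; rewrite r1 => h.
  apply: (solves_weaken (m := (12 * ((size pre).+2 - cb) + n).+3)); first by lia.
  apply: (IH (c :: g)) => //=; first by rewrite def_A cat_rcons.
  exists (c :: gf), ga; split=> //=; first by rewrite def_g.
    by move=> y; rewrite inE => /orP[/eqP->|/gfd//]; rewrite -leq_last_pos // -ltnNge.
  by case/hga=> -> -> ->; split=> //; lia.
op; op; op; goto.
apply: (solves_weaken (m := (12 * ((size pre).+2 - cb) + n).+3)); first by lia.
apply: (IH (c :: g)) => //=; first by rewrite def_A cat_rcons.
exists [::], (c :: g); split=> //=; rewrite -leq_last_pos // h /=.
  rewrite r8 def_g filter_cat size_cat addn1; congr _.+1.
  rewrite (_ : filter _ gf = [::]) //; apply/eqP; rewrite -[_ == _]negbK -has_filter.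
  by apply/hasPn => y /gfd.
by rewrite !addn0.
Qed.

Lemma init_ok Q n rg m :
  base_regs rg -> (forall k, N <= k -> m k = 0) -> {in gtn N, forall j, m j = nth 0 s j} ->
  (forall rg' m', base_regs rg' -> rg' 1 = 0 -> rg' 2 = 3 * N -> rg' 3 = 3 * N ->
    mem_tables 0 m' -> exe n (State l_main rg' m') Q) ->
  rg 1 = 0 ->
  exe (6 * N + n).+4 (State l_index rg m) Q.
Proof.
move=> br m0 ms hQ r1.
suff gen k i rg' m' : N - i = k -> i <= N -> base_regs rg' -> rg' 1 = i ->
    {in gtn N, forall j, m' j = nth 0 s j} ->
    {in gtn N, forall c, m' (N + c) = last_pos (take i s) c} ->
    (forall k', 2 * N <= k' -> m' k' = 0) ->
    exe (6 * k + n).+4 (State l_index rg' m') Q.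
  apply: (gen N 0) => //; rewrite ?subn0 //; last by move=> k hk; apply: m0; lia.
  by move=> c _; rewrite m0 ?leq_addr // take0.
elim: k i rg' m' => [|k IH] i rg' m' eki iN [r0 r5 r6] r1' ms' ml' m0'.
  have ei : i = N by lia.
  branch_eq; last by case; lia.
  move=> _; op; op; op; apply: hQ => //=; try lia; split=> //.
  - by move=> c cs; rewrite ml' ?inE ?s_lt // ei -size_s take_size.
  - by move=> c cN; rewrite m0' ?leq_addr // take0.
have ltiN : i < N by lia.
have yN := nth_lt ltiN.
rewrite mulnS -addnA; branch_eq; first by lia.
move=> _; read (nth 0 s i); first by rewrite r1' ms'.
op; write; op; goto; rewrite r1' r0.
apply: (solves_weaken (m := (6 * k + n).+4)); first by lia.
apply: (IH i.+1) => //=; try lia.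
- by move=> j; rewrite inE => jN; case: eqP => [|_]; [lia | rewrite ms' ?inE].
- move=> c cN; rewrite eqn_add2l take_succ // last_pos_rcons size_takel ?size_s ?(ltnW ltiN) //.
  by rewrite eq_sym ml'.
- by move=> k' hk'; case: eqP => [|_]; [lia | rewrite m0'].
Qed.

(** * Committing the stack *)

Lemma sortable_from_uniq u t : uniq (u ++ t) -> sortable_from u t.
Proof.
move=> ut; rewrite -[t]cats0; apply: (@sortable_from_pops pred0) => //.
rewrite (_ : filter _ _ = [::]); last by elim: (t).
rewrite cats0; apply/(@sortable_from_pop_tail [::] u [::]) => //.
  by move: ut; rewrite cat_uniq => /andP[].
exists id => //; split=> [a b|a b c]; by rewrite /= .
Qed.

Lemma sortable_from_stutter_input u t A z w : u ++ t = rcons A z ->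
  sortable_from u (t ++ z :: w) <-> sortable_from u (t ++ w).
Proof.
move=> def_ut; split.
  by apply: sortable_from_subseq => //; rewrite !cat_subseq // subseq_cons.
case=> rho inj_rho [d av]; exists rho => //; split=> // a b c h; apply/negP => /andP[ca ab].
suff h' : subseq [:: a; b; c] (u ++ t ++ w) by have := av _ _ _ h'; rewrite ca ab.
have nab : a != b by apply: contraTneq ab => ->; rewrite ltnn.
have nbc : b != c by apply: contraTneq (ltn_trans ca ab) => ->; rewrite ltnn.
move: h; rewrite catA [in X in _ -> X]catA def_ut !cat_rcons => /subseq_stutter.
by apply; rewrite /= nab nbc.
Qed.

Definition stack_inv i (A : seq nat) :=
  [/\ i <= N, uniq A, {subset A <= take i s}
    & {in take i s, forall c, c \in drop i s -> c \in A}].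

(** The filter starts at [cb.-1] because the colour that leaves may be the committed top; truncation
    covers [cb = 0]. *)
Definition compacted i (A : seq nat) cb x l : seq nat := take cb.-1 A ++
  filter (fun c => (c \in drop i s) && (c != x)) (take (l - cb.-1) (drop cb.-1 A)) ++ drop l A.

(** All outcomes of a conflict share this code, and each supplies its own equivalence for [Q]. A
    mere pop is the instance [E = i] with a dummy [x]. *)
Lemma commit_ok Q i n A cb x E l rg m :
  base_regs rg -> rg 1 = i -> rg 2 = 3 * N + size A -> rg 3 = 3 * N + cb ->
  rg 13 = x -> rg 14 = E -> rg 15 = 3 * N + l -> cb.-1 <= l -> l <= size A -> cb <= size A ->
  mem_tables i m -> mem_stack A m -> stack_inv i A ->
  i <= E <= N -> (i < E -> x \in take i s) -> x \notin drop E s ->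
  Q <-> sortable_from (compacted i A cb x l ++ filter (predC1 x) (take (E - i) (drop i s)))
          (drop E s) ->
  (forall A' rg' m', base_regs rg' -> rg' 1 = E -> rg' 2 = 3 * N + size A' ->
    rg' 3 = 3 * N + size A' -> mem_tables E m' -> mem_stack A' m' -> stack_inv E A' ->
    (forall A1 c, A' = rcons A1 c -> c \in drop E s) -> size A' <= size A + (E - i) ->
    exe (8 * size A' + n) (State l_main rg' m') (sortable_from A' (drop E s))) ->
  exe (12 * (size A - cb) + 23 * (E - i) + 8 * size A + n + 40) (State l_commit rg m) Q.
Proof.
move=> br r1 r2 r3 r13 r14 r15 cbl lA cbA mt mA [iN uA As alive] iEN xi xE hQ hC.
have As' : {subset A <= s} by move=> y /As /mem_take.
have sA := stack_size uA As'; have [r0 r5 r6] := br.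
apply: (solves_weaken (m := 4 + (12 * size (drop cb.-1 A) +
  (15 * (E - i) + (8 * (size A + (E - i)) + n).+4.+4).+1).+2)).
  by rewrite size_drop; lia.
apply: solves_iff hQ _.
op; op; op; op.
have e7 : rg 3 - rg 6 - 1 + rg 6 = 3 * N + cb.-1 by lia.
rewrite !addn0 e7.
have stC : subseq (compacted i A cb x l) A.
  rewrite -{2}(cat_take_drop cb.-1 A) cat_subseq //.
  rewrite -{2}(cat_take_drop (l - cb.-1) (drop cb.-1 A)) cat_subseq ?filter_subseq //.
  by rewrite drop_drop subnK.
have sC : size (compacted i A cb x l) <= size A by apply: size_subseq.
apply: (@compact_ok _ i _ (take cb.-1 A) (drop cb.-1 A) (3 * N + cb.-1) E x (3 * N + l)) => //=.
- by rewrite size_drop r2; lia.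
- by rewrite size_takel //; lia.
- by rewrite size_takel //; lia.
- by rewrite size_drop; lia.
- move=> j; rewrite inE size_takel ?(leq_trans (leq_pred _)) // => jcb.
  by rewrite nth_take // mA ?inE //; lia.
- by move=> y /mem_drop /As'.
- move=> j; rewrite inE size_drop => jL.
  by rewrite nth_drop -addnA mA ?inE //; lia.
move=> rg' m'; rewrite subnDl drop_drop subnK // -/(compacted i A cb x l).
move=> br' r1' r2' r13' r14' mt' mC.
apply: (@strict_ok i (compacted i A cb x l) _ E x) => //.
- exact: subseq_uniq stC uA.
- by move=> y /(mem_subseq stC) /As.
- move=> c ci cd; have := alive c ci cd; have [->|cx] := eqVneq c x; first by left.
  rewrite -{1}(cat_take_drop cb.-1 A) -{1}(cat_take_drop (l - cb.-1) (drop cb.-1 A)).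
  rewrite drop_drop subnK // !mem_cat mem_filter cd cx /=; by right.
move=> A' rg2 m2 br2 r12 r22 mt2 mA2 uA2 As2 alive2 sA2.
have As2' : {subset A' <= s} by move=> y /As2 /mem_take.
apply: (solves_weaken (m := (8 * size A' + n).+4.+4)); first by lia.
apply: (clean_ok (i := E)) => // A3 g rg3 def_A' gdead top3 br3 r1_3 r2_3 r3_3.
have iffS : sortable_from A' (drop E s) <-> sortable_from A3 (drop E s).
  by rewrite def_A'; apply: sortable_from_pop_tail; rewrite -?def_A'.
apply: solves_iff iffS _; apply: hC => //.
- by move=> j; rewrite inE => jA; rewrite mA2 ?inE def_A' ?size_cat ?ltn_addr // nth_cat jA.
- split; first by case/andP: iEN.
  + by move: uA2; rewrite def_A' cat_uniq => /andP[].
  + by move=> y yA; apply: As2; rewrite def_A' mem_cat yA.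
  + move=> c ci cd; case: (alive2 c ci cd) => [cx|]; first by rewrite -cx cd in xE.
    by rewrite def_A' mem_cat => /orP[//|/gdead]; rewrite cd.
- by move: sA2; rewrite def_A' size_cat; lia.
Qed.

(** The committed top is unfinished, so examining it again can only remove it for being [x]; this
    matches the list kept by the program with the one in the equivalences. *)
Lemma compacted_eq i A cb x l : cb <= l -> cb <= size A ->
  (forall A1 c, take cb A = rcons A1 c -> c \in drop i s) -> x \notin take cb.-1 A ->
  compacted i A cb x l = filter (predC1 x)
    (take cb A ++ filter (mem (drop i s)) (take (l - cb) (drop cb A))) ++ drop l A.
Proof.
move=> cbl cbA top xA; rewrite /compacted catA; congr (_ ++ _).
have keepE (L : seq nat) : filter (fun c => (c \in drop i s) && (c != x)) L =
    filter (predC1 x) (filter (mem (drop i s)) L).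
  by rewrite -filter_predI; apply: eq_filter => c /=; rewrite andbC.
have idx (L : seq nat) : x \notin L -> filter (predC1 x) L = L.
  by move=> xL; apply/all_filterP/allP => y; apply: contraTneq => ->.
case: cb => [|cb] in cbl cbA top xA *; first by rewrite take0 /= subn0 drop0 keepE.
rewrite /= in xA *; have := top (take cb A) (nth 0 A cb); rewrite -take_nth // => /(_ erefl) alive.
rewrite (take_nth 0) // cat_rcons filter_cat idx //; congr (_ ++ _).
rewrite (@drop_nth _ 0 cb) // -(subnSK cbl) /= alive keepE /=.
by case: eqP.
Qed.
(* The potential that pays for the remaining run: a sock pays for being read and
   pushed, and a colour above the committed part also for being committed. *)
Definition budget i cb (A : seq nat) :=
  500 * (N - i) + 8 * size A + 250 * (size A - cb) + 30.

Definition commit_budget i cb (A : seq nat) E :=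
  12 * (size A - cb) + 23 * (E - i) + 8 * size A + (500 * (N - E) + 30) + 40.

Definition agree_off (l : seq nat) (rg rg' : nat -> nat) := {in predC (mem l), rg' =1 rg}.

Lemma agree_off_upd l rg rg' a v : a \in l -> agree_off l rg rg' -> agree_off l rg (upd rg' a v).
Proof.
move=> al h b bl; rewrite /= -h //; case: eqP => // ba.
by move: bl; rewrite ba !inE al.
Qed.

Lemma agree_off_trans l1 l2 rg1 rg2 rg3 : {subset l1 <= l2} -> agree_off l2 rg1 rg2 ->
  agree_off l1 rg2 rg3 -> agree_off l2 rg1 rg3.
Proof.
move=> sub h h' b bl; rewrite -h // h' //; apply: contra bl; exact: sub.
Qed.

(** * The instructions of a decision and their cost *)

Lemma last_instrs Q n i x rg m : base_regs rg -> mem_tables i m -> x \in s -> rg 13 = x ->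
  (forall rg', agree_off [:: 14] rg rg' -> rg' 14 = (last_pos s x).+1 ->
    exe n (State l_commit rg' m) Q) ->
  exe n.+4 (State l_last rg m) Q.
Proof.
move=> [r0 r5 r6] [ms ml mseen] xs r13 hQ; have xN := s_lt xs; have lx := last_pos_ltN xs.
op; read (last_pos s x); first by rewrite r0 r13 ml.
op; goto; apply: hQ; last by rewrite /= addn1.
by do !apply: agree_off_upd => //.
Qed.

Lemma above_instrs Q n i e rg m : base_regs rg -> mem_tables i m -> e \in s -> rg 9 = e ->
  rg 2 <= 4 * N ->
  (forall rg', agree_off [:: 13; 14; 15] rg rg' -> rg' 13 = e ->
    rg' 14 = (last_pos s e).+1 -> rg' 15 = rg 2 -> exe n (State l_commit rg' m) Q) ->
  exe n.+4.+3 (State l_above rg m) Q.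
Proof.
move=> br mt es r9 r2 hQ; have eN := s_lt es; op; op; goto.
apply: (last_instrs (x := e) _ mt es) => //=; first by rewrite addn0.
move=> rg' keep r14; apply: hQ => //; rewrite ?keep //= ?addn0 //.
apply: agree_off_trans keep; first by move=> a; rewrite !inE => ->; rewrite orbT.
by do !apply: agree_off_upd => //.
Qed.

Lemma below_instrs Q n i z rg m : base_regs rg -> mem_tables i m -> z \in s -> rg 4 = z ->
  rg 10 <= 4 * N ->
  (forall rg', agree_off [:: 13; 14; 15] rg rg' -> rg' 13 = z ->
    rg' 14 = (last_pos s z).+1 -> rg' 15 = rg 10 -> exe n (State l_commit rg' m) Q) ->
  exe n.+4.+2 (State l_below rg m) Q.
Proof.
move=> br mt es r9 r2 hQ; have eN := s_lt es; op; op.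
apply: (last_instrs (x := z) _ mt es) => //=; first by rewrite addn0.
move=> rg' keep r14; apply: hQ => //; rewrite ?keep //= ?addn0 //.
apply: agree_off_trans keep; first by move=> a; rewrite !inE => ->; rewrite orbT.
by do !apply: agree_off_upd => //.
Qed.

Lemma pop_instrs Q n rg m : base_regs rg -> rg 1 <= N -> rg 2 <= 4 * N ->
  (forall rg', agree_off [:: 13; 14; 15] rg rg' -> rg' 13 = N ->
    rg' 14 = rg 1 -> rg' 15 = rg 2 -> exe n (State l_commit rg' m) Q) ->
  exe n.+3 (State l_pop rg m) Q.
Proof.
move=> [r0 r5 r6] r1 r2 hQ; op; op; op; apply: hQ; rewrite //= ?addn0 //.
by do !apply: agree_off_upd => //.
Qed.

(* [z] is at position [j] of the stack, [k] is the number of unfinished colours above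
   it, [e] the lowest of these, and [c] the top of the stack. *)
Definition found_label i cb j k z e c :=
  let lz := last_pos s z in
  if j.+1 < cb then if 1 < k then l_false else l_above
  else if k == 0 then l_pop
  else if 1 < k then l_below
  else if last_pos s e < lz then l_above
  else if c == e then l_below
  else if e \in take (lz - i) (drop i s) then l_above else l_below.

(** The fuel [5 * (lz - i)] reserved for the look-ahead is handed back where the commitment may stop
    before the last [z]; otherwise the socks up to that [z] are about to be read and pay for it. *)
Lemma found_instrs Q n i cb j k z e c (lz := last_pos s z) (le := last_pos s e)
    (A : seq nat) A0 rg m :
  base_regs rg -> rg 1 = i -> rg 2 = 3 * N + size A -> rg 3 = 3 * N + cb -> rg 4 = z ->
  rg 7 = 3 * N + j -> rg 8 = k -> j < N -> mem_tables i m -> mem_stack A m ->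
  A = rcons A0 c -> {subset A <= s} -> size A <= N -> z \in s -> i <= lz ->
  (k <> 0 -> rg 9 = e /\ e \in s) ->
  (forall rg', agree_off [:: 7; 11; 12] rg rg' ->
    exe (if (k == 0) || (le < lz) then 5 * (lz - i) + n else n)
      (State (found_label i cb j k z e c) rg' m) Q) ->
  exe (5 * (lz - i) + n).+4.+4.+4.+2 (State l_found rg m) Q.
Proof.
move=> [r0 r5 r6] r1 r2 r3 r4 r7 r8 jN [ms ml mseen] mA def_A As sA zs ilz hk hQ.
have fuel b : (if b then 5 * (lz - i) + n else n) <= 5 * (lz - i) + n.
  by case: b; rewrite ?leq_addl.
have lzN : lz < N := last_pos_ltN zs; have zN := s_lt zs.
have hQ' rg' l n' : (if (k == 0) || (le < lz) then 5 * (lz - i) + n else n) <= n' ->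
    agree_off [:: 7; 11; 12] rg rg' -> l = found_label i cb j k z e c ->
    exe n' (State l rg' m) Q.
  by move=> nn' keep ->; apply: solves_weaken nn' _; apply: hQ.
rewrite /found_label -/lz -/le in hQ'.
op; branch_lt; rewrite r3 r7.
  move=> lt; have deep : j.+1 < cb by lia.
  rewrite deep in hQ'; branch_lt; rewrite r8 => k1; apply: hQ'; try by do !apply: agree_off_upd.
  - by apply: leq_trans (fuel _) _; lia.
  - by rewrite k1.
  - by apply: leq_trans (fuel _) _; lia.
  - by rewrite ltnNge k1.
move=> ge; have /negbTE shallow : ~~ (j.+1 < cb) by lia.
rewrite shallow in hQ'; branch_eq; rewrite r8.
  move=> k0; apply: hQ'; [|by do !apply: agree_off_upd|by rewrite k0].
  by apply: leq_trans (fuel _) _; lia.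
move=> k0; have [r9 es] := hk k0; move/eqP/negbTE: (k0) => nk0; rewrite nk0 in hQ'.
have eN := s_lt es; have leN : le < N := last_pos_ltN es.
branch_lt; rewrite ?r8 => k1.
  by apply: hQ'; [by apply: leq_trans (fuel _) _; lia | do !apply: agree_off_upd | rewrite k1].
have /negbTE k1' : ~~ (1 < k) by rewrite -leqNgt.
rewrite k1' /= in hQ'.
have sA0 : size A = (size A0).+1 by rewrite def_A size_rcons.
have cN : c < N by apply/s_lt/As; rewrite def_A mem_rcons mem_head.
op; read le; first by rewrite r0 r9 ml.
op; read lz; first by rewrite r0 r4 ml.
branch_lt => hlt.
  by apply: hQ'; [by apply: leq_trans (fuel _) _; lia | do !apply: agree_off_upd | rewrite hlt].
have /negbTE hlt' : ~~ (le < lz) by rewrite -leqNgt.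
rewrite hlt' /= in hQ'.
op; read c.
  have -> : rg 2 - 1 = 3 * N + size A0 by lia.
  by rewrite mA ?inE ?sA0 // def_A nth_rcons ltnn eqxx.
branch_eq; rewrite r9 => ce.
  by apply: hQ'; [by lia | do !apply: agree_off_upd | rewrite ce eqxx].
move/eqP/negbTE: ce => ce; rewrite ce in hQ'.
op; rewrite addn0; apply: (solves_weaken (m := (5 * (lz - i) + n).+1)); first by lia.
apply: (look_ok (j := i) (l := lz) (e := e)) => //=; first by rewrite ilz.
move=> rg' keep; apply: hQ' => //; apply: agree_off_trans keep.
  by move=> a; rewrite !inE => /orP[->|->]; rewrite ?orbT.
by do !apply: agree_off_upd.
Qed.

Definition event_budget i cb A := budget i cb A - 12 * ((size A).+2 - cb) - 30.

Lemma commit_budget_late i cb A E : i < E <= N -> cb <= size A ->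
  commit_budget i cb A E + 5 * (E - i) + 10 <= event_budget i cb A.
Proof. by rewrite /commit_budget /event_budget /budget; lia. Qed.

(** A pop reads no sock; it is paid by the uncommitted colours, at least one of which exists and all
    of which get committed or removed. *)
Lemma commit_budget_now i cb A : i < N -> cb < size A ->
  commit_budget i cb A i + 10 <= event_budget i cb A.
Proof. by rewrite /commit_budget /event_budget /budget; lia. Qed.

(** A look-ahead up to [l] is affordable because the colour then chosen leaves until some [E] beyond
    [l]; [b] marks the cases in which its fuel was handed back. *)
Lemma look_budget i cb A l E (b : bool) (n := event_budget i cb A - 5 * (l - i)) :
  i <= l -> i < E <= N -> cb <= size A -> (l < E) || b ->
  commit_budget i cb A E + 10 <= (if b then 5 * (l - i) + n else n).
Proof.
move=> il iE cbA h; have := commit_budget_late iE cbA; rewrite /n.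
by case: b h => h; [lia | rewrite orbF in h; lia].
Qed.

Lemma look_budget_le i cb A l : i <= l < N -> cb <= size A ->
  5 * (l - i) <= event_budget i cb A.
Proof.
move=> /andP[il lN] cbA; have := @commit_budget_late i cb A l.+1; rewrite ltnS il lN.
by move=> /(_ isT cbA); lia.
Qed.

Lemma leq_slack n k : k <= 10 -> k + n <= n + 10.
Proof. by rewrite addnC leq_add2l. Qed.

(** Here each label reached by the program meets the equivalence that justifies it. The three exits
    towards [l_commit] are treated as [above], [below] and [pop]; both rejections come from
    [event_deep]. *)
Lemma event_ok i cb (A : seq nat) z c A0 rg m (w := drop i s) (u := take cb A) (t := drop cb A) :
  base_regs rg -> rg 1 = i -> rg 2 = 3 * N + size A -> rg 3 = 3 * N + cb -> rg 4 = z ->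
  rg 7 = 3 * N + size A -> rg 8 = 0 ->
  mem_tables i m -> mem_stack A m -> stack_inv i A -> cb <= size A ->
  (forall A1 y, u = rcons A1 y -> y \in w) -> i < N -> w = z :: drop i.+1 s ->
  z \in A -> A = rcons A0 c -> c != z ->
  (forall x E l rg', base_regs rg' -> rg' 1 = i -> rg' 2 = 3 * N + size A ->
    rg' 3 = 3 * N + cb -> rg' 13 = x -> rg' 14 = E -> rg' 15 = 3 * N + l ->
    cb <= l <= size A -> i <= E <= N -> (E = i -> cb < size A) ->
    (i < E -> x \in take i s) -> x \notin drop E s -> x \notin take cb.-1 A ->
    sortable_from u (t ++ w) <-> sortable_from (filter (predC1 x)
      (u ++ filter (mem w) (take (l - cb) t)) ++ drop l A
      ++ filter (predC1 x) (take (E - i) w)) (drop E s) ->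
    exe (commit_budget i cb A E) (State l_commit rg' m) (sortable_from u (t ++ w))) ->
  exe (12 * ((size A).+2 - cb) + (event_budget i cb A + 14)).+3 (State l_scan rg m)
    (sortable_from u (t ++ w)).
Proof.
move=> br r1 r2 r3 r4 r7 r8 mt mA inv cbA top ltiN def_w zA def_A cz.
have [iN uA As alive] := inv; have As' : {subset A <= s} by move=> y /As /mem_take.
have sA := stack_size uA As'; have leA : 3 * N + size A <= 4 * N by clear -sA; lia.
move=> commit; have zw : z \in w by rewrite def_w mem_head.
have zs : z \in s by apply: As'.
have su : size u = cb by rewrite size_takel.
have uniq_ut : uniq (u ++ t) by rewrite cat_take_drop.
have topw : forall u1 y, u = rcons u1 y -> y \in z :: drop i.+1 s by rewrite -def_w.
have skip_prefix (p g : seq nat) y : A = p ++ g -> cb.-1 <= size p -> y \notin p ->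
    y \notin take cb.-1 A.
  move=> def_A' cbp; apply: contra; rewrite def_A' take_cat.
  case: ltnP => [_ /mem_take//|]; rewrite leq_eqVlt ltnNge cbp orbF => /eqP<-.
  by rewrite subnn take0 cats0.
have w_split y : y \in w -> w = rcons (take (last_pos s y - i) w) y ++ drop (last_pos s y).+1 s.
  move=> yw; have ys : y \in s by apply: mem_drop yw.
  have iy : i <= last_pos s y by rewrite leq_last_pos.
  rewrite -take_last_pos // -[LHS](cat_take_drop ((last_pos s y).+1 - i)) drop_drop subnK //.
  exact: leqW.
have after y : y \in w -> i < (last_pos s y).+1 <= N.
  move=> yw; have ys : y \in s by apply: mem_drop yw.
  by rewrite ltnS leq_last_pos // yw last_pos_ltN.
have tk : take (size A - cb) t = t by rewrite take_oversize // size_drop.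
have /andP[ilz lzN] := after z zw; rewrite ltnS in ilz.
apply: (@scan_ok _ i _ A A [::] cb z) => //; rewrite ?cats0 //.
- by exists [::], [::].
- move=> p g rg' def_A' lt; rewrite addnS; eapply solves_halt; first by reflexivity.
  split=> // hS; exfalso; rewrite def_w in hS.
  have def_ut : u ++ t = p ++ z :: g by rewrite cat_take_drop.
  have [] := event_deep def_ut uniq_ut topw _ hS; rewrite su ?(ltnW lt) // => e.
  by rewrite e ltnn in lt.
move=> p g rg1 def_A' cbp br1 r1_1 r2_1 r3_1 r4_1 r7_1 [gf [ga [def_g deadgf r8_1 hga]]].
have def_ut : u ++ t = p ++ z :: g by rewrite cat_take_drop.
have sAp : size A = (size p + size g).+1 by rewrite def_A' size_cat addnS.
have uniq_pzg : uniq (p ++ z :: g) by rewrite -def_A'.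
have zp : z \notin p.
  by move: uniq_pzg; rewrite cat_uniq /= negb_or => /and3P[_ /andP[]].
have gz y : y \in g -> y \notin rcons p z.
  move=> yg; move: uniq_pzg; rewrite -cat_rcons cat_uniq => /and3P[_ /hasPn h _].
  exact: h.
have g0 : g != [::].
  apply: contraNneq cz => g0; move: def_A'; rewrite def_A g0 cats1.
  by move/rcons_inj => [_ ->].
have last_g y : last y g = c.
  have := congr1 (last y) def_A'; rewrite def_A last_rcons last_cat /= => ->.
  by case: (g) g0.
have filter_g : filter (mem w) g = filter (mem w) ga.
  rewrite def_g filter_cat (_ : filter _ gf = [::]) //.
  by apply/eqP; rewrite -[_ == _]negbK -has_filter; apply/hasPn => y /deadgf.
set k := size (filter (mem w) ga) in r8_1.
set e := head 0 ga.
have ga_e : k <> 0 -> [/\ ga = e :: behead ga, e \in w, e \in g, rg1 9 = e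
    & rg1 10 = 3 * N + (size p).+1 + size gf].
  rewrite /k /e => k0; have ga0 : ga != [::] by apply: contra_notN k0 => /eqP->.
  have [hw -> ->] := hga ga0; split=> //; first by case: (ga) ga0.
  by rewrite def_g mem_cat; case: (ga) ga0 => //= a l _; rewrite mem_head orbT.
have above rg2 : agree_off [:: 7; 11; 12] rg1 rg2 -> k <> 0 -> size (filter (mem w) g) <= 1 ->
    (exists p', [/\ u ++ filter (mem w) t = rcons (rcons p' z) e, subseq p' p
                  & {subset p' <= u ++ w}]) ->
    [\/ (size p).+1 < size u, z \in drop (last_pos s e).+1 s
    | last e g != e /\ exists v0' v2', w = rcons v0' z ++ v2' /\ e \in v0'] ->
    exe (commit_budget i cb A (last_pos s e).+1).+4.+3 (State l_above rg2 m)
      (sortable_from u (t ++ w)).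
  move=> keep k0 size_fg [p' [def_st pp' p'u]] hC.
  have [_ ew eg r9_1 _] := ga_e k0; have es : e \in s by apply: mem_drop ew.
  have fg : filter (mem w) g = [:: e].
    have : e \in filter (mem w) g by rewrite mem_filter /= ew eg.
    by case: (filter _ g) size_fg => [//|a [|b l]] // _; rewrite mem_seq1 => /eqP->.
  have [r0_1 r5_1 r6_1] := br1.
  have br2 : base_regs rg2 by split; rewrite keep.
  apply: (above_instrs (e := e) br2 mt es); rewrite ?keep ?r9_1 ?r2_1 //.
  move=> rg3 keep3 r13 r14 r15; have /andP[iE EN] := after e ew.
  apply: (commit e _ (size A)) => //; rewrite ?keep3 ?keep // ?cbA ?leqnn //.
  - by split; rewrite keep3 ?keep.
  - by rewrite (ltnW iE).
  - by move=> eE; rewrite eE ltnn in iE.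
  - by move=> _; apply: As; rewrite def_A' mem_cat inE eg !orbT.
  - exact: drop_last_pos.
  - apply: (skip_prefix (rcons p z) g); rewrite ?cat_rcons ?size_rcons ?gz //.
    by rewrite -subn1 leq_subLR add1n.
  have := @event_choose_above u t p g (drop i.+1 s) z def_ut uniq_ut topw p' e
    (take (last_pos s e - i) w) (drop (last_pos s e).+1 s).
  rewrite -def_w => /(_ def_st pp' p'u fg (w_split e ew) (drop_last_pos es) hC) h.
  apply: iff_trans h _; rewrite take_last_pos //.
  rewrite tk drop_size cat0s catA filter_cat.
  exact: iff_refl.
have below rg2 : agree_off [:: 7; 11; 12] rg1 rg2 -> k <> 0 -> size u <= (size p).+1 ->
    has (mem w) (behead ga) \/ (e \in drop (last_pos s z).+1 s)
      && ((behead ga == [::]) || (e \notin take (last_pos s z - i) w)) ->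
    exe (commit_budget i cb A (last_pos s z).+1).+4.+2 (State l_below rg2 m)
      (sortable_from u (t ++ w)).
  move=> keep k0 shallow hC.
  have [def_ga ew eg r9_1 r10_1] := ga_e k0.
  have [r0_1 r5_1 r6_1] := br1.
  have br2 : base_regs rg2 by split; rewrite keep.
  have sgf : (size p).+1 + size gf <= size A.
    by rewrite sAp addSn ltnS leq_add2l def_g size_cat leq_addr.
  apply: (below_instrs (z := z) br2 mt zs); rewrite ?keep ?r4_1 ?r10_1 //.
    by rewrite -addnA; apply: leq_trans leA; rewrite leq_add2l.
  move=> rg3 keep3 r13 r14 r15; have /andP[iE EN] := after z zw.
  rewrite -addnA in r15; set l := (size p).+1 + size gf in sgf r15.
  have dropA : drop l A = ga.
    rewrite def_A' def_g -cat_rcons catA drop_size_cat // size_cat size_rcons.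
    by [].
  have cbl : cb <= l by rewrite -su; apply: leq_trans shallow (leq_addr _ _).
  apply: (commit z _ l) => //; rewrite ?keep3 ?keep // ?cbl //.
  - by split; rewrite keep3 ?keep.
  - by rewrite (ltnW iE).
  - by move=> eE; rewrite eE ltnn in iE.
  - by move=> _; apply: As.
  - exact: drop_last_pos.
  - apply: (skip_prefix p (z :: g)) => //.
    by rewrite -subn1 leq_subLR add1n -su.
  have def_t : t = take (l - cb) t ++ e :: behead ga.
    rewrite -{1}(cat_take_drop (l - cb) t) -def_ga -dropA; congr (_ ++ _).
    by rewrite drop_drop subnK.
  rewrite def_ga in def_g.
  have := @event_choose_below u t p g (drop i.+1 s) z def_ut uniq_ut topw (take (l - cb) t) gf e
    (behead ga) (take (last_pos s z - i) w) (drop (last_pos s z).+1 s).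
  rewrite -def_w => /(_ def_t def_g deadgf ew shallow (w_split z zw) (drop_last_pos zs) hC) h.
  apply: iff_trans h _; rewrite take_last_pos // catA filter_cat dropA {2}def_ga.
  rewrite -cat_cons [filter _ ((e :: _) ++ _)]filter_cat.
  rewrite [filter (predC1 z) (e :: behead ga)](_ : _ = e :: behead ga); first exact: iff_refl.
  apply/all_filterP/allP => y yga /=; apply: contraTneq yga => ->.
  have := @gz z; rewrite mem_rcons mem_head => h'; apply/negP => zga.
  by have := h'; rewrite def_g mem_cat zga orbT => /(_ isT).
have pop rg2 : agree_off [:: 7; 11; 12] rg1 rg2 -> k = 0 -> size u <= (size p).+1 ->
    exe (commit_budget i cb A i).+3 (State l_pop rg2 m) (sortable_from u (t ++ w)).
  move=> keep k0 shallow; have [r0_1 r5_1 r6_1] := br1.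
  have br2 : base_regs rg2 by split; rewrite keep.
  apply: pop_instrs => //; rewrite ?keep ?r1_1 ?r2_1 //.
  move=> rg3 keep3 r13 r14 r15.
  (* The dummy [N] is no colour, so removing it changes nothing. *)
  have Ns L : {subset L <= s} -> N \notin L.
    by move=> Ls; apply/negP => /Ls /s_lt; rewrite ltnn.
  apply: (commit N _ (size A)) => //; rewrite ?keep3 ?keep // ?cbA ?leqnn //.
  - by split; rewrite keep3 ?keep.
  - move=> _; rewrite sAp -su; apply: leq_ltn_trans shallow _; rewrite ltnS.
    by rewrite -addn1 leq_add2l lt0n size_eq0.
  - by rewrite ltnn.
  - by apply: Ns => y /mem_drop.
  - by apply: Ns => y /mem_take /As'.
  have deadg : {in g, forall y, y \notin w}.
    move=> y yg; apply/negP => yw; have := filter_g.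
    rewrite (size0nil k0) => /eqP; rewrite -[_ == _]negbK -has_filter => /hasPn/(_ y yg).
    by rewrite /= yw.
  have := @event_pop u t p g (drop i.+1 s) z def_ut uniq_ut topw g0 shallow.
  rewrite -def_w => /(_ deadg) h; apply: iff_trans h _.
  rewrite subnn take0 /= cats0 drop_size cats0 tk.
  have -> : filter (predC1 N) (u ++ filter (mem w) t) = u ++ filter (mem w) t.
    have Nu : N \notin u by apply: Ns => y /mem_take /As'.
    have Nt : N \notin t by apply: Ns => y /mem_drop /As'.
    apply/all_filterP/allP => y yut /=; apply: contraTneq yut => ->.
    by rewrite mem_cat mem_filter (negbTE Nu) (negbTE Nt) andbF.
  exact: iff_refl.
have jN : size p < N by apply: leq_trans sA; rewrite sAp ltnS leq_addr.
have ek : k <> 0 -> rg1 9 = e /\ e \in s.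
  by case/ga_e => _ ew _ -> _; split=> //; apply: mem_drop ew.
have ezw : 5 * (last_pos s z - i) <= event_budget i cb A.
  by apply: look_budget_le; rewrite ?ilz.
pose F (b : bool) := if b then 5 * (last_pos s z - i)
  + (event_budget i cb A - 5 * (last_pos s z - i))
  else event_budget i cb A - 5 * (last_pos s z - i).
have fuel E b : i < E <= N -> (last_pos s z < E) || b -> commit_budget i cb A E + 10 <= F b.
  by move=> iE; apply: look_budget.
rewrite addnC -(subnKC ezw).
apply: (@found_instrs _ _ i cb (size p) k z e c A A0 rg1 m br1) => // rg2 keep.
rewrite /found_label; set b := (k == 0) || _; rewrite -/(F b).
have e_late : k <> 0 -> commit_budget i cb A (last_pos s e).+1 + 10 <= F b.
  move=> k0; have [_ ew _ _ _] := ga_e k0; apply: fuel => //; first exact: after.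
  by rewrite /b ltnS; case: (leqP (last_pos s z)) => //; rewrite orbT.
have z_late : commit_budget i cb A (last_pos s z).+1 + 10 <= F b.
  by apply: fuel; rewrite ?ltnSn //; apply: after.
case: ltnP => [deep|shallow].
  have [g1 [c' [def_u def_g']]] : exists g1 c', u = p ++ z :: rcons g1 c' /\ g = rcons g1 c' ++ t.
    by apply: (deep_split def_ut uniq_ut); rewrite su.
  have c'w : c' \in w by apply: (top (p ++ z :: g1)); rewrite def_u rcons_cat.
  have c'g : c' \in g by rewrite def_g' mem_cat mem_rcons mem_head.
  have k0 : k <> 0.
    move=> k0; have : c' \in filter (mem w) g by rewrite mem_filter /= c'w.
    by rewrite filter_g (size0nil k0).
  case: ltnP => [k1|k1].
    apply: (solves_weaken (m := 1)); last first.
      eapply solves_halt; first by reflexivity.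
      split=> // hS; exfalso; rewrite def_w in hS.
      have [] := event_deep def_ut uniq_ut topw _ hS; rewrite ?su // -def_w filter_g -/k => _.
      by rewrite leqNgt k1.
    by apply: leq_trans z_late; rewrite addn_gt0 orbT.
  have size_fg : size (filter (mem w) g) <= 1 by rewrite filter_g.
  apply: solves_weaken; last apply: above => //.
  - by apply: leq_trans (e_late k0); apply: (@leq_slack _ 7).
  - have sg1 : g1 = [::].
      apply: size0nil; have := congr1 size def_u; rewrite su size_cat /= size_rcons => e1.
      move: cbp; rewrite e1; case: (size g1) => // n; by rewrite !addnS !ltnS -ltn_subRL subnn.
    have fg : filter (mem w) t = [::] /\ e = c'.
      have := size_fg; rewrite def_g' sg1 /= c'w ltnS leqn0 size_eq0 => /eqP ft; split=> //.
      have : c' \in filter (mem w) g by rewrite mem_filter /= c'w.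
      have [def_ga ew _ _ _] := ga_e k0.
      rewrite filter_g def_ga /= ew inE => /orP[/eqP->//|].
      have := size_fg; rewrite filter_g def_ga /= ew ltnS leqn0 size_eq0 => /eqP->.
      by [].
    exists p; rewrite fg.1 fg.2 cats0; split=> //.
      by rewrite def_u sg1 -!cats1 -catA.
    by move=> y yp; rewrite mem_cat def_u mem_cat yp.
  - by apply: Or31; rewrite su.
have shallow_u : size u <= (size p).+1 by rewrite su.
case: eqP => [k0|k0].
  apply: solves_weaken; last exact: pop.
  rewrite /F /b k0 eqxx /= subnKC //; apply: leq_trans (commit_budget_now ltiN _).
    by apply: (@leq_slack _ 3).
  by rewrite sAp -su; apply: leq_ltn_trans shallow_u _; rewrite ltnS -addn1 leq_add2l lt0n size_eq0.
have [def_ga ew eg _ _] := ga_e k0.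
have exe_below : has (mem w) (behead ga) \/ (e \in drop (last_pos s z).+1 s)
      && ((behead ga == [::]) || (e \notin take (last_pos s z - i) w)) ->
    exe (F b)
      (State l_below rg2 m) (sortable_from u (t ++ w)).
  move=> hC; apply: solves_weaken; last exact: below hC.
  by apply: leq_trans z_late; apply: (@leq_slack _ 6).
case: ltnP => [k1|k1].
  apply: exe_below; left; rewrite has_filter -size_eq0 -lt0n.
  by move: k1; rewrite /k def_ga /= ew ltnS.
have size_fg : size (filter (mem w) g) <= 1 by rewrite filter_g.
have exe_above : z \in drop (last_pos s e).+1 s \/
    last e g != e /\ (exists v0' v2', w = rcons v0' z ++ v2' /\ e \in v0') ->
    exe (F b)
      (State l_above rg2 m) (sortable_from u (t ++ w)).
  move=> hC; apply: solves_weaken; last apply: above => //.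
  - by apply: leq_trans (e_late k0); apply: (@leq_slack _ 7).
  - have := conflict_kept (drop i.+1 s) def_ut shallow_u; rewrite -def_w.
    have -> : filter (mem w) g = [:: e].
      have : e \in filter (mem w) g by rewrite mem_filter /= ew eg.
      by case: (filter _ g) size_fg => [//|a [|? l]] // _; rewrite mem_seq1 => /eqP->.
    by case=> p' hp' [pp' p'u]; exists p'; rewrite hp' cats1.
  - by case: hC => hC; [apply: Or32 | apply: Or33].
case: ltnP => [lt|le]; first by apply: exe_above; left; rewrite -leq_last_pos.
have es : e \in s by apply: mem_drop ew.
have ez : e != z by have := gz e eg; rewrite mem_rcons inE negb_or => /andP[].
(* Distinct colours have distinct last positions, so [e] strictly outlasts [z]. *)
have ev2 : e \in drop (last_pos s z).+1 s.
  rewrite -leq_last_pos // ltn_neqAle le andbT; apply: contraNneq ez => ezl.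
  by rewrite -(nth_last_pos es) -ezl nth_last_pos.
have ege : e \notin behead ga.
  move: uniq_pzg; rewrite def_g def_ga cat_uniq /= => /and4P[_ _ _].
  by rewrite cat_uniq /= => /and4P[].
(* If [e] is the top of the stack, no finished colour lies above it and [behead ga] is empty. *)
case: eqP => [ce|/eqP ce].
  apply: exe_below; right; rewrite ev2 /=; apply/orP; left.
  have := last_g e; rewrite def_g def_ga last_cat /= ce.
  case: (lastP (behead ga)) ege => // l y.
  by rewrite mem_rcons inE last_rcons negb_or eq_sym => /andP[/eqP].
case: ifP => [ev0|/negbT ev0].
  apply: exe_above; right; rewrite last_g ce; split=> //.
  by exists (take (last_pos s z - i) w), (drop (last_pos s z).+1 s); rewrite -w_split.
by apply: exe_below; right; rewrite ev2 ev0 orbT.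
Qed.

Lemma scan_budget i cb A : i < N -> cb <= size A ->
  (12 * ((size A).+2 - cb) + (event_budget i cb A + 14)).+3 <= (budget i cb A - 12).+2.
Proof. by rewrite /event_budget /budget; lia. Qed.

Lemma commit_budget_gt i cb A A' E : i <= E <= N -> (E = i -> cb < size A) ->
  size A' <= size A + (E - i) -> budget E (size A') A' < budget i cb A.
Proof.
move=> /andP[iE EN] hE sA'; rewrite /budget.
by have [eE|nE] := eqVneq E i; [have := hE eE; lia | lia].
Qed.

(** * The main loop *)

Lemma main_ok i cb A rg m :
  base_regs rg -> rg 1 = i -> rg 2 = 3 * N + size A -> rg 3 = 3 * N + cb ->
  mem_tables i m -> mem_stack A m -> stack_inv i A -> cb <= size A ->
  (forall A1 c, take cb A = rcons A1 c -> c \in drop i s) ->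
  exe (budget i cb A) (State l_main rg m)
    (sortable_from (take cb A) (drop cb A ++ drop i s)).
Proof.
(* The potential is also the induction measure: the number of unread socks would not do, since a pop
   reads none. *)
have [k] := ubnP (budget i cb A); elim: k => // k IH in i cb A rg m *; rewrite ltnS => ltk.
move=> br r1 r2 r3 mt mA inv cbA top.
have [r0 r5 r6] := br; have [iN uA As alive] := inv; have [ms ml mseen] := mt.
have As' : {subset A <= s} by move=> y /As /mem_take.
have sA := stack_size uA As'.
pose f := budget i cb A - 12; have budgetE : budget i cb A = f.+4.+4.+4.
  by rewrite /f /budget; lia.
rewrite budgetE; branch_eq; rewrite r1 r0.
  move=> eiN; eapply solves_halt; first by reflexivity.
  have -> : drop i s = [::] by rewrite drop_oversize ?size_s ?eiN.
  split=> // _; rewrite cats0.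
  by apply: sortable_from_uniq; rewrite cat_take_drop.
move=> /eqP neiN; have ltiN : i < N by rewrite ltn_neqAle neiN.
set z := nth 0 s i; have zN : z < N := nth_lt ltiN.
have def_w : drop i s = z :: drop i.+1 s by apply: drop_pred.
have zw : z \in drop i s by rewrite def_w mem_head.
have dropi c : c \in drop i.+1 s -> c \in drop i s.
  by rewrite def_w inE => ->; rewrite orbT.
have drop_ne c : c \in drop i s -> c != z -> c \in drop i.+1 s.
  by rewrite def_w inE => /orP[->|].
read z; first by rewrite r1 ms.
op; read (z \in take i s : nat); first by rewrite r5 mseen ?inE.
branch_eq; last first.
  case: (boolP (z \in take i s)) => // zi _.
  have zA : z \notin A by apply: contra zi => /As.
  have sA' : size A < N.
    have : size (rcons A z) <= N; last by rewrite size_rcons.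
    apply: stack_size; first by rewrite rcons_uniq zA.
    by move=> y; rewrite mem_rcons inE => /orP[/eqP->|/As'//]; rewrite mem_nth ?size_s.
  write; write; op; op; goto; rewrite r1 r2 r5.
  apply: (solves_weaken (m := budget i.+1 cb (rcons A z))).
    by rewrite /f /budget size_rcons; lia.
  have -> : take cb A = take cb (rcons A z) by rewrite -cats1 takel_cat.
  rewrite def_w -cat_rcons -[rcons (drop cb A) z]drop_rcons //.
  apply: IH => //=; rewrite ?size_rcons ?addn1 ?addnS ?(leqW cbA) //.
  - by move: ltk; rewrite /budget size_rcons; lia.
  - by apply: mem_tables_stack; [lia | apply: mem_tables_new].
  - by apply: mem_stack_push => //; lia.
  - split=> //; first by rewrite rcons_uniq zA.
    + move=> c; rewrite take_succ // !mem_rcons !inE => /orP[->//|/As->].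
      by rewrite orbT.
    + move=> c; rewrite take_succ // !mem_rcons !inE => /orP[->//|ci /dropi cd].
      by rewrite (alive c ci cd) orbT.
  - move=> A1 c; rewrite -cats1 takel_cat // => def_u; apply: drop_ne; first exact: top def_u.
    apply: contraNneq zA => <-; apply: (mem_take (n0 := cb)).
    by rewrite def_u mem_rcons mem_head.
case: (boolP (z \in take i s)) => // zi _; have zA := alive z zi zw.
have [A0 [c def_A]] : exists A0 c, A = rcons A0 c.
  by case: (lastP A) zA => // A0 c _; exists A0, c.
have cN : c < N by apply/s_lt/As'; rewrite def_A mem_rcons mem_head.
have sA0 : size A = (size A0).+1 by rewrite def_A size_rcons.
op; read c.
  have -> : rg 2 - 1 = 3 * N + size A0 by lia.
  by rewrite mA ?inE ?sA0 // def_A nth_rcons ltnn eqxx.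
branch_eq.
  move=> cz.
  have iffS : sortable_from (take cb A) (drop cb A ++ drop i s) <->
              sortable_from (take cb A) (drop cb A ++ drop i.+1 s).
    rewrite def_w; apply: (sortable_from_stutter_input (A := A0)).
    by rewrite cat_take_drop def_A cz.
  apply: solves_iff iffS _.
  have inv' : stack_inv i.+1 A.
    split=> // y; rewrite take_succ // mem_rcons inE.
      by move/As => ->; rewrite orbT.
    by case/orP=> [/eqP->//|yi /dropi]; apply: alive.
  have mt' : mem_tables i.+1 m by apply: mem_tables_old.
  (* Reading this [z] may finish it. That endangers the invariant on the committed top only when the
     whole stack is committed, and cleaning then restores it. *)
  op; branch_eq; rewrite r2 r3.
    move=> /addnI ecb; rewrite -ecb take_size drop_size cat0s.
    apply: (solves_weaken (m := (8 * size A + (500 * (N - i.+1) + 30)).+4.+4)).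
      by rewrite /f /budget; lia.
    apply: (clean_ok (i := i.+1)) => //=; first by lia.
    move=> A' g rg' def_A' gdead top' br' r1' r2' r3'.
    have iffS' : sortable_from A (drop i.+1 s) <-> sortable_from A' (drop i.+1 s).
      by rewrite def_A'; apply: sortable_from_pop_tail; rewrite -?def_A'.
    apply: solves_iff iffS' _; have [iN' uA' Asi' alive'] := inv'.
    apply: (solves_weaken (m := budget i.+1 (size A') A')); first by rewrite /budget; lia.
    have := IH i.+1 (size A') A' rg' m; rewrite take_size drop_size cat0s; apply=> //.
    - by move: ltk; rewrite /budget def_A' size_cat; lia.
    - by move=> j; rewrite inE => jA; rewrite mA ?inE def_A' ?size_cat ?ltn_addr // nth_cat jA.
    - split=> //.
      + by move: uA; rewrite def_A' cat_uniq => /andP[].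
      + by move=> y yA; apply: Asi'; rewrite def_A' mem_cat yA.
      + move=> y yi yd; have := alive' y yi yd; rewrite def_A' mem_cat => /orP[//|/gdead].
        by rewrite yd.
  move=> /eqP; rewrite eqn_add2l => necb; goto.
  apply: (solves_weaken (m := budget i.+1 cb A)); first by rewrite /f /budget; lia.
  apply: IH => //=; first by move: ltk; rewrite /budget; lia.
  - by rewrite r1 addn1.
  - move=> A1 y def_u; apply: drop_ne; first exact: top def_u.
    apply: contraTneq uA => yz; rewrite -(cat_take_drop cb A) cat_uniq.
    have : z \in drop cb A.
      have ltcb : cb < size A by rewrite ltn_neqAle eq_sym necb.
      rewrite def_A drop_rcons; last by move: ltcb; rewrite sA0.
      by rewrite mem_rcons cz mem_head.
    move=> zt; apply/negP => /and3P[_ /hasPn/(_ _ zt)].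
    by rewrite def_u mem_rcons -yz mem_head.

move=> /eqP cz; op; op; apply: solves_weaken (scan_budget ltiN cbA) _.
apply: (@event_ok i cb A z c A0) => //=; rewrite ?addn0 //.
move=> x E l rg' br' r1' r2' r3' r13' r14' r15' /andP[cbl lA] iEN hE xi xE xA iffS.
apply: (@commit_ok _ i (500 * (N - E) + 30) A cb x E l rg' m) => //.
- by apply: leq_trans (leq_pred _) cbl.
- by rewrite compacted_eq // -catA.
move=> A' rg2 m2 br2 r1_2 r2_2 r3_2 mt2 mA2 inv2 top2 sA2.
apply: (solves_weaken (m := budget E (size A') A')).
  by rewrite /budget subnn muln0 addn0 addnCA addnA.
have := IH E (size A') A' rg2 m2; rewrite take_size drop_size cat0s; apply=> //.
exact: leq_trans (commit_budget_gt iEN hE sA2) ltk.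
Qed.

Lemma program_ok : exe (510 * N + 100) (init_state s) (foot_sortable s).
Proof.
apply: solves_iff (foot_sortableE s) _.
apply: (solves_weaken (m := (6 * N + budget 0 0 [::]).+4.+2)).
  by rewrite /budget /=; lia.
rewrite /init_state; op; op; rewrite size_s.
apply: init_ok => //=; first by split=> /=; lia.
- by move=> k kN; rewrite nth_default ?size_s.
move=> rg m br r1 r2 r3 mt.
have := @main_ok 0 0 [::] rg m; rewrite /= drop0 addn0; apply=> //.
  by split=> // c; rewrite take0.
by case.
Qed.

End Correctness.

(** * Invariance under injective recolouring *)

Lemma foot_run_map (T U : Type) (f : T -> U) s st o :
  foot_run s st o -> foot_run (map f s) (map f st) (map f o).
Proof.
by elim=> *; [apply: FootDone | apply: FootPush | apply: FootPop].
Qed.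

Lemma foot_run_map_inv (T U : Type) (f : T -> U) s st o :
  foot_run (map f s) (map f st) o -> exists2 o', o = map f o' & foot_run s st o'.
Proof.
suff gen fs fst : foot_run fs fst o -> forall s st, fs = map f s -> fst = map f st ->
    exists2 o', o = map f o' & foot_run s st o' by move=> h; apply: gen h _ _ erefl erefl.
elim=> {fs fst o} [|x fs fst o _ IH|x fs fst o _ IH] {}s {}st.
- by case: s st => [|? ?] [|? ?] // _ _; exists [::] => //; apply: FootDone.
- case: s => [//|y s] [ex efs] est; have [|o' -> h] := IH s (y :: st) efs; first by rewrite ex est.
  by exists o' => //; apply: FootPush.
- case: st => [//|y st] efs [-> est]; have [o' -> h] := IH s st efs est.
  by exists (y :: o') => //; apply: FootPop.
Qed.

Lemma foot_sortable_map (T U : Type) (f : T -> U) s : injective f ->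
  foot_sortable (map f s) <-> foot_sortable s.
Proof.
move=> inj_f; split=> [[o fo co]|[o ro co]].
  have [o' def_o ro] := @foot_run_map_inv T U f s [::] o fo.
  exists o' => // x0 i j k ij jk ko eik; apply: inj_f.
  have := co (f x0) i j k ij jk; rewrite def_o size_map.
  rewrite !(nth_map x0) ?(leq_ltn_trans ij) ?(leq_ltn_trans jk) //.
  by rewrite eik; apply.
exists (map f o); first exact: (foot_run_map f ro).
move=> u0 i j k ij jk; rewrite size_map => ko.
have [x0 _] : exists x0 : T, True by case: (o) ko => // x0; exists x0.
have jo := leq_ltn_trans jk ko; have io := leq_ltn_trans ij jo.
by rewrite !(nth_map x0) // => /inj_f/(co x0 i j k ij jk ko) ->.
Qed.

Theorem theorem1p2 :
  exists (P : program) (W T : nat -> nat),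
    [/\ bigO W (fun N => N),
        bigO T (fun N => N * trunc_log 2 N)
      & forall (N : nat) (s : N.-tuple 'I_N),
          exists (t : nat) (b : bool),
            [/\ halts_in (W N) P (init_state [seq val c | c <- s]) t b,
                t <= T N
              & b <-> foot_sortable s]].
Proof.
exists foot_program, (fun N => 4 * N + 2), (fun N => 510 * N + 100); split.
- by exists 5, 2 => n hn; lia.
(* The bound is linear; from [n = 2] on the logarithm is at least 1, and [610 = 510 + 100] absorbs
   the constant term. *)
- exists 610, 2 => n hn /=; have l0 : 0 < trunc_log 2 n by rewrite trunc_log_gt0.
  apply: (@leq_trans (610 * n)); first by lia.
  by rewrite leq_mul2l /= leq_pmulr.
- move=> N s; have size_s : size [seq val c | c <- s] = N by rewrite size_map size_tuple.
  have s_lt : {in [seq val c | c <- s], forall c, c < N} by move=> _ /mapP[c _ ->]; apply: ltn_ord.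
  have [t [b [h tT bQ]]] := program_ok size_s s_lt erefl.
  by exists t, b; split=> //; apply: iff_trans bQ _; apply: foot_sortable_map val_inj.
Qed.
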